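(* Let $d\ge 2$, $s\in(0,1)$, and let $M(t)=\int_0^{|t|}m(\tau)\,d\tau$ be an $N$-function. Let $\Omega$ be a bounded open subset of $\mathbb{R}^d$ with $C^{0,1}$-regularity and bounded boundary. Assume that $$1<m_0:=\inf_{t>0}\frac{tm(t)}{M(t)}\le m^0:=\sup_{t>0}\frac{tm(t)}{M(t)}<m_0^*:=\frac{dm_0}{d-m_0}<\infty$$ and that $$\int_0^1\frac{M^{-1}(\tau)}{\tau^{\frac{d+s}{d}}}\,d\tau<\infty,\qquad \int_1^{+\infty}\frac{M^{-1}(\tau)}{\tau^{\frac{d+s}{d}}}\,d\tau=\infty .$$ Then: 1. The embedding $W^{s,M}(\Omega)\hookrightarrow L^{M_*}(\Omega)$ is continuous. 2. Moreover, for any $N$-function $B$ with $B\prec\prec M_*$, the embedding $W^{s,M}(\Omega)\hookrightarrow L^{B}(\Omega)$ is compact.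
   Context: An $N$-function is an even, continuous, convex function $M:\mathbb{R}\to[0,\infty)$ with $M(t)/t\to0$ as $t\to0$ and $M(t)/t\to+\infty$ as $t\to+\infty$; equivalently $M(t)=\int_0^{|t|}m(\tau)d\tau$ with $m$ non-decreasing, right continuous, $m(0)=0$, $m(t)>0$ for $t>0$, $m(t)\to\infty$ as $t\to\infty$. $M^{-1}$ is the inverse of $M$ on $[0,\infty)$. The Sobolev conjugate $M_*$ of $M$ is the $N$-function (extended evenly to $\mathbb{R}$) defined by $M_*^{-1}(t)=\int_0^t \frac{M^{-1}(\tau)}{\tau^{(d+s)/d}}d\tau$ for $t\ge0$. For $N$-functions $A,B$, $B\prec\prec A$ means: for each $a>0$ there exists $x_a\ge0$ such that $B(x)\le A(ax)$ for all $x\ge x_a$. For an $N$-function $M$ and an open set $\Omega\subset\mathbb{R}^d$, $L^M(\Omega)$ is the set of (classes of) real measurable functions $u$ on $\Omega$ with $\int_\Omega M(\lambda u)dx<\infty$ for some $\lambda>0$, with the Luxemburg norm $\|u\|_{(M,\Omega)}=\inf\{\lambda>0:\int_\Omega M(u/\lambda)dx\le1\}$. The fractional Orlicz-Sobolev space is $$W^{s,M}(\Omega)=\Big\{u\in L^M(\Omega):\int_\Omega\int_\Omega M\Big(\frac{u(x)-u(y)}{|x-y|^s}\Big)\frac{dxdy}{|x-y|^d}<\infty\Big\}$$ with norm $\|u\|_{(s,M,\Omega)}=\|u\|_{(M,\Omega)}+[u]_{(s,M,\Omega)}$, where $[u]_{(s,M,\Omega)}=\inf\{\lambda>0:\int_\Omega\int_\Omega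 M(\frac{u(x)-u(y)}{\lambda|x-y|^s})\frac{dxdy}{|x-y|^d}\le1\}$. *)

(* Defs.v *)
From HB Require Import structures.
From mathcomp Require Import all_boot all_order all_algebra.
From mathcomp Require Import all_classical all_reals all_analysis.
Set Implicit Arguments.
Unset Strict Implicit.
Unset Printing Implicit Defensive.
Import Order.TTheory GRing.Theory Num.Theory.
Import numFieldNormedType.Exports.
Local Open Scope classical_set_scope.
Local Open Scope ring_scope.

Definition measure_rV_display : measure_display. Proof. by constructor. Qed.

(* The sigma-algebra generated by the coordinates, i.e. the Borel one; this is
   the construction the library uses for [n.-tuple T]. *)
Section measurable_rV.
Variables (R : realType) (n : nat).

Let coors : 'I_n -> 'rV[R]_n -> measurableTypeR R := fun i x => x ord0 i.

Let rV_set0 : g_sigma_preimage coors set0.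
Proof. exact: sigma_algebra0. Qed.

Let rV_setC A : g_sigma_preimage coors A -> g_sigma_preimage coors (~` A).
Proof. exact: sigma_algebraC. Qed.

Let rV_bigcup (F : (set 'rV[R]_n)^nat) :
  (forall i, g_sigma_preimage coors (F i)) ->
  g_sigma_preimage coors (\bigcup_i (F i)).
Proof. exact: sigma_algebra_bigcup. Qed.

HB.instance Definition _ := @isMeasurable.Build measure_rV_display
  'rV[R]_n (g_sigma_preimage coors) rV_set0 rV_setC rV_bigcup.

Lemma measurable_coord (i : 'I_n) :
  measurable_fun [set: 'rV[R]_n] (fun x => x ord0 i : measurableTypeR R).
Proof.
move=> _ A mA; rewrite setTI; apply: sub_sigma_algebra.
by rewrite (bigD1 i)//=; left; exists A => //; rewrite setTI.
Qed.

Lemma measurable_fun_rVP d (T : measurableType d) (f : T -> 'rV[R]_n) :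
  (forall i, measurable_fun setT (fun t => f t ord0 i : measurableTypeR R)) ->
  measurable_fun setT f.
Proof.
move=> mf; pose G := \big[setU/set0]_(i < n)
  preimage_set_system setT (coors i) measurable.
have GE : @measurable _ 'rV[R]_n = <<s G >> by [].
have GP A : G A -> exists i (B : set (measurableTypeR R)),
    measurable B /\ A = coors i @^-1` B.
  rewrite /G; apply: (big_ind (fun X : set (set 'rV[R]_n) => X A ->
    exists i (B : set (measurableTypeR R)),
      measurable B /\ A = coors i @^-1` B)) => //.
  - by move=> X Y HX HY [/HX|/HY].
  - by move=> i _ [B mB <-]; exists i, B; rewrite setTI.
refine (@measurability _ _ _ _ _ _ G GE _).
by move=> _ [A /GP[i [B [mB ->]]] <-]; exact: (mf i measurableT B mB).
Qed.

End measurable_rV.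

Section lebesgue_rV.
Variable R : realType.

Definition rV_cons n (p : measurableTypeR R * 'rV[R]_n) : 'rV[R]_n.+1 :=
  row_mx (p.1 : R)%:M p.2.

Lemma rV_cons0 n p : @rV_cons n p ord0 ord0 = p.1.
Proof.
have := row_mxEl ((p.1 : R)%:M : 'M[R]_1) p.2 ord0 ord0.
by rewrite [X in _ = X]mxE eqxx mulr1n => <-; congr (row_mx _ _ _ _); exact/val_inj.
Qed.

Lemma rV_consS n p (i : 'I_n) : @rV_cons n p ord0 (lift ord0 i) = p.2 ord0 i.
Proof.
have <- := row_mxEr ((p.1 : R)%:M : 'M[R]_1) p.2 ord0 i.
by congr (row_mx _ _ _ _); exact/val_inj.
Qed.

Lemma measurable_rV_cons n : measurable_fun setT (@rV_cons n).
Proof.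
apply: measurable_fun_rVP => i.
have [->|[j ->]] : i = ord0 \/ exists j, i = lift ord0 j.
- by case: (unliftP ord0 i) => [j ->|->]; [right; exists j|left].
- by under eq_fun do rewrite rV_cons0; exact: measurable_fst.
- under eq_fun do rewrite rV_consS.
  apply: (measurableT_comp (measurable_coord j)); exact: measurable_snd.
Qed.


Definition rV_uncons n (x : 'rV[R]_n.+1) : measurableTypeR R * 'rV[R]_n :=
  (x ord0 ord0, \row_j x ord0 (lift ord0 j)).

Lemma rV_consK n : cancel (@rV_cons n) (@rV_uncons n).
Proof.
move=> p; rewrite /rV_uncons rV_cons0 [RHS]surjective_pairing; congr pair.
by apply/rowP => j; rewrite mxE rV_consS.
Qed.

Lemma measurable_rV_uncons n : measurable_fun setT (@rV_uncons n).
Proof.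
apply: measurable_fun_pair; first exact: measurable_coord.
by apply: measurable_fun_rVP => i; under eq_fun do rewrite mxE;
  exact: measurable_coord.
Qed.

Section lebesgue_rV_step.
Variables (n : nat) (mu : {sigma_finite_measure set 'rV[R]_n -> \bar R}).
Local Open Scope ereal_scope.

Definition lebesgue_rV_step : set 'rV[R]_n.+1 -> \bar R :=
  pushforward (@lebesgue_measure R \x mu) (@rV_cons n).

Let step0 : lebesgue_rV_step set0 = 0.
Proof. by have mc := @measurable_rV_cons n; exact: measure0. Qed.

Let step_ge0 A : 0 <= lebesgue_rV_step A.
Proof. by have mc := @measurable_rV_cons n; exact: measure_ge0. Qed.

Let step_sigma_additive : semi_sigma_additive lebesgue_rV_step.
Proof.
by have mc := @measurable_rV_cons n; exact: measure_semi_sigma_additive.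
Qed.

HB.instance Definition _ := isMeasure.Build _ _ _ lebesgue_rV_step
  step0 step_ge0 step_sigma_additive.

Let step_sigma_finite : sigma_finite setT lebesgue_rV_step.
Proof.
have /sigma_finiteP[F [TF ndF Foo]] := sigma_finiteT (@lebesgue_measure R).
have /sigma_finiteP[G [TG ndG Goo]] := sigma_finiteT mu.
exists (fun i => @rV_uncons n @^-1` (F i `*` G i)).
  rewrite -preimage_bigcup (_ : \bigcup_i _ = setT) ?preimage_setT//.
  rewrite -setXTT TF TG predeqE => -[x y]; split.
    by move=> [i _ []/=]; split; exists i.
  move=> [/= [i _ Fix] [k _ Gky]]; exists (maxn i k) => //; split.
  - by move: x Fix; exact/subsetPset/ndF/leq_maxl.
  - by move: y Gky; exact/subsetPset/ndG/leq_maxr.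
move=> i; have [mF Fi] := Foo i; have [mG Gi] := Goo i; split.
  rewrite -[X in measurable X]setTI; apply: measurable_rV_uncons => //.
  exact: measurableX.
rewrite /lebesgue_rV_step /pushforward -comp_preimage.
rewrite (_ : _ \o _ = id) ?preimage_id; last first.
  by apply/funext => p; exact: rV_consK.
by rewrite product_measure1E// lte_mul_pinfty// ge0_fin_numE.
Qed.

HB.instance Definition _ := Measure_isSigmaFinite.Build _ _ _ lebesgue_rV_step
  step_sigma_finite.

End lebesgue_rV_step.

(* d-dimensional Lebesgue measure: the d-fold product of the one-dimensional
   one; 'rV_0 is a point. *)
Fixpoint lebesgue_rV (d : nat) : {sigma_finite_measure set 'rV[R]_d -> \bar R} :=
  if d is d'.+1 then lebesgue_rV_step (lebesgue_rV d') else \d_(0 : 'rV[R]_0).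

End lebesgue_rV.
Arguments lebesgue_rV {R} d.

Section N_functions.
Variable R : realType.
Implicit Types M A B m : R -> R.

(* Positivity away from 0 is not a consequence of the other fields; it is what
   makes M invertible on [0, +oo[ and corresponds to m(t) > 0 for t > 0 in the
   integral representation below. *)
Record nfunction M : Prop := NFunction {
  nfunction_even : forall t, M (- t) = M t;
  nfunction_continuous : continuous M;
  nfunction_convex : @convex_function R R^o setT M;
  nfunction_ge0 : forall t, 0 <= M t;
  nfunction_gt0 : forall t, 0 < t -> 0 < M t;
  nfunction_cvg0 : M t / t @[t --> 0^'] --> (0 : R);
  nfunction_cvgy : M t / t @[t --> +oo] --> +oo }.

Record nfunction_density M m : Prop := NFunctionDensity {
  density_ndecr : {in `[0, +oo[ &, {homo m : x y / x <= y}};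
  density_rcont : forall t, 0 <= t -> m x @[x --> t^'+] --> m t;
  density0 : m 0 = 0;
  density_gt0 : forall t, 0 < t -> 0 < m t;
  density_cvgy : m t @[t --> +oo] --> +oo;
  density_int : forall t,
    (M t)%:E = (\int[lebesgue_measure]_(tau in `[0%R, `|t|%R]) (m tau)%:E)%E }.

Definition ndominated B A :=
  forall a, 0 < a -> exists2 xa, 0 <= xa & forall x, xa <= x -> B x <= A (a * x).

(* The infimum below is over a nonempty set of nonnegative reals, so [inf] is
   the genuine one; the supremum may be infinite. *)
Definition lower_index M m : R := inf [set t * m t / M t | t in `]0, +oo[].

Definition upper_index M m : \bar R :=
  ereal_sup [set (t * m t / M t)%:E | t in `]0, +oo[].

Definition critical_exponent (d : nat) (p : R) : \bar R :=
  if p == d%:R then +oo%E else (d%:R * p / (d%:R - p))%:E.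

(* Inverse of the restriction of f to [0, +oo[. *)
Definition halfline_inv (f : R -> R) : R -> R :=
  'pinv_(fun=> 0) `[0, +oo[%classic f.

Definition conj_integrand (d : nat) (s : R) M (tau : R) : R :=
  halfline_inv M tau / tau `^ ((d%:R + s) / d%:R).

Definition sobolev_conj_inv d s M (t : R) : R :=
  \int[lebesgue_measure]_(tau in `[0, t]) conj_integrand d s M tau.

Definition sobolev_conj d s M (x : R) : R :=
  halfline_inv (sobolev_conj_inv d s M) `|x|.

End N_functions.

Definition boundary (R : realType) d (Omega : set 'rV[R]_d) : set 'rV[R]_d :=
  closure Omega `\` interior Omega.

(* Euclidean norm; the norm [`|x|] the library puts on 'rV[R]_d is the max norm,
   which induces the same topology and the same bounded sets. *)
Definition enorm (R : realType) d (x : 'rV[R]_d) : R :=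
  Num.sqrt (\sum_(i < d) x ord0 i ^+ 2).

(* Near each boundary point, and after an orthogonal change of coordinates,
   Omega is the strict epigraph of a Lipschitz function of d - 1 of the
   coordinates. *)
Definition C01_regular (R : realType) d (Omega : set 'rV[R]_d) : Prop :=
  forall x0, boundary Omega x0 ->
  exists (Q : 'M[R]_d) (i : 'I_d) (gamma : 'rV[R]_d.-1 -> R) (L r : R),
  [/\ Q *m Q^T = 1%:M, 0 < r,
      forall y z, `|gamma y - gamma z| <= L * enorm (y - z) &
      forall x, enorm (x - x0) < r ->
        (Omega x <-> gamma (col' i (x *m Q)) < (x *m Q) ord0 i)].

Section Orlicz_spaces.
Variables (R : realType) (d : nat).
Implicit Types (M : R -> R) (s : R) (Omega : set 'rV[R]_d).
Implicit Types (u : 'rV[R]_d -> R).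
Local Open Scope ereal_scope.
Local Notation leb := (lebesgue_rV d).

(* Functions are not quotiented by a.e. equality on Omega: their values outside
   Omega are irrelevant, and the norms below only depend on the class. *)
Definition orlicz_modular M Omega u : \bar R :=
  \int[leb]_(x in Omega) (M (u x))%:E.

Definition orlicz_space M Omega : set ('rV[R]_d -> R) :=
  [set u | measurable_fun Omega u /\
    exists2 l : R, (0 < l)%R & orlicz_modular M Omega (l \*o u)%R < +oo].

Definition luxemburg_norm M Omega u : \bar R :=
  ereal_inf [set l%:E | l in
    [set l : R | (0 < l)%R /\ orlicz_modular M Omega (l^-1 \*o u)%R <= 1]].

Definition gagliardo_modular s M Omega u : \bar R :=
  \int[leb]_(x in Omega) \int[leb]_(y in Omega)
    (M ((u x - u y) / enorm (x - y) `^ s) / enorm (x - y) ^+ d)%:E.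

Definition gagliardo_seminorm s M Omega u : \bar R :=
  ereal_inf [set l%:E | l in
    [set l : R | (0 < l)%R /\ gagliardo_modular s M Omega (l^-1 \*o u)%R <= 1]].

Definition frac_sobolev_space s M Omega : set ('rV[R]_d -> R) :=
  [set u | orlicz_space M Omega u /\ gagliardo_modular s M Omega u < +oo].

Definition frac_sobolev_norm s M Omega u : \bar R :=
  luxemburg_norm M Omega u + gagliardo_seminorm s M Omega u.

End Orlicz_spaces.

Section embeddings.
Variables (T : Type) (R : realType).
Implicit Types (X Y : set (T -> R)) (nX nY : (T -> R) -> \bar R).
Local Open Scope ereal_scope.

Definition continuous_embedding X nX Y nY : Prop :=
  X `<=` Y /\ exists2 C : R, (0 < C)%R & forall u, X u -> nY u <= C%:E * nX u.

Definition compact_embedding X nX Y nY : Prop :=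
  continuous_embedding X nX Y nY /\
  forall u_ : nat -> T -> R, (forall n, X (u_ n)) ->
    (exists K : R, forall n, nX (u_ n) <= K%:E) ->
    exists (phi : nat -> nat) (v : T -> R),
      [/\ {homo phi : m n / (m < n)%N}, Y v &
          nY (u_ (phi n) \- v)%R @[n --> \oo] --> 0].

End embeddings.

(* Main.v *)
(** Write th = s/d, N for the inverse of M, J for the inverse of the Sobolev
    conjugate F = M_*, so that J' = N(t) t^(-1-th) is nonincreasing and
    J f - J (f/2) >= N(f) f^(-th) / 2.

    A Lipschitz domain contains, at each of its points and at every small scale
    r, a cube of side comparable to r; this measure density is all that is used
    of the boundary.  Let u have M-modular and Gagliardo modular at most 1, and
    let Phi(x) be the inner integral of the Gagliardo modular.  Suppose that
    {F(lam u) >= f/2} has measure at most 2 kap / f, and let F(lam u(x)) >= f.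
    The ball around x of volume 4 kap / f contains a set of volume 2 kap / f on
    which u differs from u(x) by (J f - J (f/2)) / lam at least; the powers of f
    cancel and Phi(x) >= c f / lam.  Integrating, {F(lam u) >= f} has measure at
    most kap / f if lam is small, so the assumption propagates by dyadic
    induction from f = 1, where it follows from the M-modular.  Then
    F(lam u) <= 2 + (lam / c) Phi pointwise, which is the continuous embedding.

    For compactness, on each small cube Q of a grid u is L^1-close to its value
    at a point of Q where Phi + M(u) does not exceed its mean by more than 1.
    These values are bounded for each Q, so by a diagonal argument a bounded
    sequence has a subsequence that is Cauchy in measure; the modular bound for
    F and B << F upgrade this to convergence in the norm of L^B. *)

Require Import Defs.
From mathcomp Require Import all_boot all_order all_algebra.
From mathcomp Require Import all_classical all_reals all_analysis.
From mathcomp Require Import measurable_realfun ring lra.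
Set Implicit Arguments.
Unset Strict Implicit.
Unset Printing Implicit Defensive.
Import Order.TTheory GRing.Theory Num.Theory.
Import numFieldNormedType.Exports.
Local Open Scope classical_set_scope.
Local Open Scope ring_scope.

(** * N-functions and the Sobolev conjugate *)

Section nfunction_theory.
Variables (R : realType) (M : R -> R).
Hypothesis HM : nfunction M.

(** By continuity [M 0] is the limit at 0 of [(M t / t) * t], a product of two factors tending to
    0. *)
Lemma nfunction0 : M 0 = 0.
Proof.
have M0c : M t @[t --> 0^'] --> M 0.
  by apply: cvg_within_filter; exact: (@nfunction_continuous _ _ HM 0).
have M0l : M t @[t --> 0^'] --> (0 : R).
  have h : (M t / t) * t @[t --> 0^'] --> (0 * 0 : R).
    apply: cvgM; first exact: (nfunction_cvg0 HM).
    by apply: cvg_within.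
  rewrite mul0r in h; apply: cvg_trans h.
  apply: near_eq_cvg; near=> t.
  by rewrite divfK//; near: t; exact: nbhs_dnbhs_neq.
exact: (cvg_unique _ M0c M0l).
Unshelve. all: by end_near. Qed.

Lemma nfunction_norm x : M `|x| = M x.
Proof. by have [//|x0] := ger0P x; rewrite (nfunction_even HM). Qed.

(** Convexity on the segment from 0 to [x], combined with [M 0 = 0]. Most later uses of convexity go
    through this inequality or its reciprocal form [nfunctionZ_ge]. *)
Lemma nfunctionZ_le (k x : R) : 0 <= k <= 1 -> M (k * x) <= k * M x.
Proof.
move=> /andP[k0 k1].
pose t : {i01 R} := Itv01 k0 k1.
have := nfunction_convex HM t (in_setT x) (in_setT 0).
rewrite convRE/= nfunction0 mulr0 addr0; congr (M _ <= _).
by change (k * x + unstable.onem k * 0 = k * x); rewrite mulr0 addr0.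
Qed.

Lemma nfunction_le (x y : R) : 0 <= x -> x <= y -> M x <= M y.
Proof.
move=> x0 xy; have [y0|y0] := eqVneq y 0.
  by have -> : x = y by lra.
have {}y0 : 0 < y by lra.
have xy1 : 0 <= x / y <= 1 by rewrite divr_ge0 ?ler_pdivrMr ?mul1r//= ltW.
have := nfunctionZ_le y xy1; rewrite divfK ?gt_eqF// => h.
apply: (le_trans h); rewrite ler_piMl ?(nfunction_ge0 HM)//.
by case/andP: xy1.
Qed.

Lemma nfunction_lt (x y : R) : 0 <= x -> x < y -> M x < M y.
Proof.
move=> x0 xy; have y0 : 0 < y by lra.
have xy1 : 0 <= x / y < 1 by rewrite divr_ge0 ?ltr_pdivrMr ?mul1r//= ltW.
have xy2 : 0 <= x / y <= 1 by case/andP: xy1 => -> /ltW ->.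
have := nfunctionZ_le y xy2; rewrite divfK ?gt_eqF// => h.
apply: (le_lt_trans h); rewrite gtr_pMl ?(nfunction_gt0 HM)//.
by case/andP: xy1.
Qed.

Lemma nfunction_le_norm (x y : R) : `|x| <= `|y| -> M x <= M y.
Proof.
by move=> xy; rewrite -(nfunction_norm x) -(nfunction_norm y) nfunction_le.
Qed.

Lemma nfunctionZ_ge (k x : R) : 1 <= k -> k * M x <= M (k * x).
Proof.
move=> k1; have k0 : 0 < k by lra.
have kI : 0 <= k^-1 <= 1 by rewrite invr_ge0 ltW//= invf_le1.
have := nfunctionZ_le (k * x) kI.
by rewrite mulrA mulVf ?gt_eqF// mul1r -ler_pdivlMl ?invr_gt0// invrK.
Qed.

Lemma nfunction_ge_cancel (x y : R) : 0 <= x -> M y <= M x -> y <= x.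
Proof. by move=> x0; apply: contraTT; rewrite -!ltNge; exact: nfunction_lt. Qed.

Lemma nfunction_surj (y : R) : 0 <= y -> exists2 x, 0 <= x & M x = y.
Proof.
move=> y0.
have [a a0 ya] : exists2 a, 0 <= a & y <= M a.
  have /cvgryPge/(_ (y + 1)) [A [_ HA]] := nfunction_cvgy HM.
  (* The lower bound 1 on [a] turns [y + 1 <= M a / a] into [y <= M a]. *)
  pose a := Num.max (A + 1) 1; exists a; first by rewrite le_max ler01 orbT.
  have a1 : 1 <= a by rewrite le_max lexx orbT.
  have : A < a by rewrite lt_max ltrDl ltr01.
  move=> /HA /=; rewrite ler_pdivlMr; last lra.
  move=> h; apply: le_trans h; nra.
have := @IVT _ M 0 a y a0.
case.
- by apply: continuous_subspaceT; exact: (@nfunction_continuous _ _ HM).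
- by rewrite nfunction0 min_l ?(nfunction_ge0 HM)// max_r ?(nfunction_ge0 HM)// y0.
- by move=> c; rewrite in_itv/= => /andP[c0 _] <-; exists c.
Qed.

End nfunction_theory.

(** * Right inverses on the half-line *)

Section halfline_inv_theory.
Variables (R : realType) (f : R -> R).
Hypothesis f_surj : forall y, 0 <= y -> exists2 x, 0 <= x & f x = y.

Lemma halfline_inv_ge0 y : 0 <= y -> 0 <= halfline_inv f y.
Proof.
move=> y0; have : set_surj (`[0, +oo[%classic : set R) (`[0, +oo[%classic : set R) f.
  move=> z /=; rewrite in_itv/= andbT => /f_surj[x x0 <-].
  by exists x => //=; rewrite in_itv/= x0.
move=> fs; have := @surjpinv_image_sub _ _ (fun=> 0) _ _ _ fs (halfline_inv f y).
rewrite /= in_itv/= andbT; apply; exists y => //.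
by rewrite /= in_itv/= y0.
Qed.

Lemma halfline_invK y : 0 <= y -> f (halfline_inv f y) = y.
Proof.
move=> /f_surj[x x0 <-]; apply: pinvK; rewrite inE; exists x => //.
by rewrite /= in_itv/= x0.
Qed.

End halfline_inv_theory.

Section nfunction_inverse.
Variables (R : realType) (M : R -> R).
Hypothesis HM : nfunction M.
Local Notation N := (halfline_inv M).

Lemma nfunction_inv_ge0 y : 0 <= y -> 0 <= N y.
Proof. exact: (halfline_inv_ge0 (nfunction_surj HM)). Qed.

Lemma nfunction_invK y : 0 <= y -> M (N y) = y.
Proof. exact: (halfline_invK (nfunction_surj HM)). Qed.

Lemma nfunction_inv_le x y : 0 <= x -> x <= y -> N x <= N y.
Proof.
move=> x0 xy; apply: (nfunction_ge_cancel HM).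
  exact/nfunction_inv_ge0/(le_trans x0).
by rewrite !nfunction_invK// (le_trans x0).
Qed.

Lemma nfunction_inv_gt0 y : 0 < y -> 0 < N y.
Proof.
move=> y0; rewrite lt_neqAle nfunction_inv_ge0 ?ltW// andbT.
apply/eqP => h; have := nfunction_invK (ltW y0).
by rewrite -h (nfunction0 HM) => h'; rewrite h' ltxx in y0.
Qed.

(** The trace of the concavity of the inverse: [M (k * N x) >= k * x] for [k = y / x >= 1], so
    [N y <= k * N x]. *)
Lemma nfunction_inv_div x y : 0 < x -> x <= y -> N y / y <= N x / x.
Proof.
move=> x0 xy; have y0 : 0 < y by lra.
rewrite ler_pdivrMr// mulrAC -mulrA.
have yx : 1 <= y / x by rewrite ler_pdivlMr// mul1r.
rewrite mulrC; apply: (nfunction_ge_cancel HM).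
  by rewrite mulr_ge0 ?nfunction_inv_ge0 ?ltW// divr_gt0.
apply: le_trans (nfunctionZ_ge HM (N x) yx).
by rewrite (nfunction_invK (ltW x0)) (nfunction_invK (ltW y0)) divfK ?gt_eqF.
Qed.

End nfunction_inverse.

(** * Primitives of nonincreasing integrands *)

Section decreasing_integrand.
Variables (R : realType) (g : R -> R).
Hypothesis g_ge0 : forall t, 0 <= t -> 0 <= g t.
Hypothesis g_dec : forall x y, 0 < x -> x <= y -> g y <= g x.
Hypothesis g_meas : measurable_fun (`[0, +oo[%classic : set R) g.
Hypothesis g_int : (\int[lebesgue_measure]_(t in `[0%R, 1%R]) (g t)%:E < +oo)%E.
Hypothesis g_inty :
  (\int[lebesgue_measure]_(t in `[1%R, +oo[) (g t)%:E = +oo)%E.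

Let J (t : R) := \int[lebesgue_measure]_(tau in `[0, t]) g tau.

Let g_measS (D : set R) : measurable D -> D `<=` `[0, +oo[ ->
  measurable_fun D (EFin \o g).
Proof.
move=> mD D0; apply/measurable_EFinP; apply: measurable_funS g_meas => //.
Qed.

(** On [[0, 1]] integrability is the hypothesis [g_int]; on []1, b]] the integrand is at most
    [g 1]. *)
Lemma integrable_decreasing (b : R) :
  lebesgue_measure.-integrable `[0, b] (EFin \o g).
Proof.
have S0 (c : R) : `[0, c] `<=` `[0, +oo[.
  by move=> x /=; rewrite !in_itv/= andbT => /andP[].
have i1 : lebesgue_measure.-integrable `[0, 1] (EFin \o g).
  apply/integrableP; split; first exact: g_measS.
  under eq_integral => x.
    rewrite inE/= in_itv/= => /andP[x0 _].
    rewrite ger0_norm ?g_ge0//; over.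
  exact: g_int.
have [b1|b1] := leP b 1.
  apply: integrableS i1 => //.
  by move=> x /=; rewrite !in_itv/= => /andP[-> xb]/=; exact: le_trans b1.
apply/integrableP; split; first exact: g_measS.
under eq_integral => x.
  rewrite inE/= in_itv/= => /andP[x0 _].
  rewrite ger0_norm ?g_ge0//; over.
have S1 : (`]1, b]%classic : set R) `<=` `[0, +oo[.
  by move=> x /=; rewrite !in_itv/= andbT => /andP[x1 _]; lra.
have U : (`[0, b]%classic : set R) = `[0, 1] `|` `]1, b].
  apply/seteqP; split => x /=; rewrite !in_itv/=.
    move=> /andP[x0 xb]; have [x1|x1] := leP x 1; [left|right].
      by rewrite x0.
    by rewrite xb.
  by case=> /andP[x0 x1]; apply/andP; split; lra.
rewrite U ge0_integral_setU//.
- apply: lte_add_pinfty => //.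
  apply: (@le_lt_trans _ _ (\int[lebesgue_measure]_(x in `]1%R, b]) (cst (g 1)%:E x))%E).
    apply: ge0_le_integral => //.
    + by move=> x /S1/=; rewrite in_itv/= andbT lee_fin => /g_ge0.
    + exact: g_measS.
    + by move=> x /=; rewrite in_itv/= lee_fin => /andP[x1 _]; apply: g_dec; lra.
  rewrite integral_cst//= lebesgue_measure_itv/= lte_fin b1 -EFinB -EFinM.
  exact: ltry.
- by rewrite -U; exact: g_measS.
- by move=> x; rewrite -U/= in_itv/= lee_fin => /andP[/g_ge0].
- apply/disj_setPS => x /=; rewrite !in_itv/= => -[/andP[_ x1] /andP[x2 _]]; lra.
Qed.

Lemma primitive_diff (a b : R) : 0 <= a -> a <= b ->
  J b - J a = \int[lebesgue_measure]_(t in `]a, b]) g t.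
Proof.
move=> a0 ab; apply: Rintegral_itvB; rewrite ?bnd_simp//.
exact: integrable_decreasing.
Qed.

Let integrable_oc (a b : R) : 0 <= a ->
  lebesgue_measure.-integrable `]a, b] (EFin \o g).
Proof.
move=> a0; apply: integrableS (integrable_decreasing b) => //.
by move=> x /=; rewrite !in_itv/= => /andP[x0 ->]; rewrite andbT; lra.
Qed.

Let mu_oc (a b : R) : a <= b ->
  fine (lebesgue_measure (`]a, b]%classic : set R)) = b - a.
Proof.
move=> ab; rewrite lebesgue_measure_itv/= lte_fin.
case: ltP => // ba; rewrite /=; lra.
Qed.

Let integrable_cst_oc (a b c : R) :
  lebesgue_measure.-integrable `]a, b] (EFin \o (fun=> c)).
Proof.
apply/integrableP; split; first exact: measurable_cst.
rewrite /= integral_cst//= lebesgue_measure_itv/= lte_fin.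
by case: ifP => _; rewrite ?mule0// -EFinB -EFinM ltry.
Qed.

Lemma primitive_diff_ge (a b : R) : 0 <= a -> a <= b ->
  (b - a) * g b <= J b - J a.
Proof.
move=> a0 ab; rewrite primitive_diff// -(mu_oc ab) mulrC.
rewrite -Rintegral_cst//; apply: le_Rintegral => //.
  exact: integrable_oc.
move=> x /=; rewrite in_itv/= => /andP[ax xb].
by apply: g_dec => //; lra.
Qed.

(** Unlike the lower bound, this needs [a] to be positive: [g] may blow up at 0, and monotonicity is
    assumed only on positive reals. *)
Lemma primitive_diff_le (a b : R) : 0 < a -> a <= b ->
  J b - J a <= (b - a) * g a.
Proof.
move=> a0 ab; rewrite primitive_diff ?(ltW a0)// -(mu_oc ab) mulrC.
rewrite -Rintegral_cst//; apply: le_Rintegral => //.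
  exact/integrable_oc/ltW.
move=> x /=; rewrite in_itv/= => /andP[ax xb].
by apply: g_dec => //; lra.
Qed.

Lemma primitive0 : J 0 = 0.
Proof. by rewrite /J set_itv1 Rintegral_set1. Qed.

Lemma primitive_le (a b : R) : 0 <= a -> a <= b -> J a <= J b.
Proof.
move=> a0 ab; have := primitive_diff_ge a0 ab.
have := g_ge0 (le_trans a0 ab) => h1 h2; nra.
Qed.

(** A bound on [J] would pass, by monotone convergence along [[1, n + 1]], to the integral over [[1,
    +oo[], which is infinite. *)
Lemma primitive_unbounded (y : R) : exists2 b, 0 <= b & y <= J b.
Proof.
apply: contrapT => h.
have Jy b : 0 <= b -> J b <= y.
  move=> b0; have [//|yb] := leP (J b) y.
  by exfalso; apply: h; exists b => //; exact: ltW.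
pose F n : set (measurableTypeR R) := `[1%R, (n.+1%:R : R)]%classic.
have F0 n : F n `<=` (`[0, +oo[%classic : set R).
  by move=> x; rewrite /F/= !in_itv/= andbT => /andP[x1 _]; lra.
have FE : \bigcup_i F i = `[1%R, +oo[%classic.
  apply/seteqP; split => [x [i _]|x]; rewrite /F/= !in_itv/= andbT.
    by case/andP.
  move=> x1; exists (Num.trunc x) => //.
  by rewrite /= in_itv/= x1/=; exact/ltW/truncnS_gt.
have mF n : measurable_fun (F n) (EFin \o g) by apply: g_measS;
    [exact: measurable_itv|exact: F0].
have Fcvg : (\int[lebesgue_measure]_(x in F i) (g x)%:E)%E @[i --> \oo] -->
    (\int[lebesgue_measure]_(x in \bigcup_i F i) (g x)%:E)%E.
  apply: ge0_nondecreasing_set_cvg_integral => //.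
    move=> n m nm; apply/subsetPset => x; rewrite /F/= !in_itv/=.
    by move=> /andP[-> xn]/=; rewrite (le_trans xn)// ler_nat ltnS.
    by move=> i; exact: measurable_itv.
  by move=> i x /F0; rewrite /= in_itv/= andbT lee_fin => /g_ge0.
have : (\int[lebesgue_measure]_(x in \bigcup_i F i) (g x)%:E <= y%:E)%E.
  rewrite -(cvg_lim _ Fcvg)//; apply: lime_le; first by apply/cvg_ex; eexists;
      exact: Fcvg.
  near=> n; have n0 : 0 <= (n.+1%:R : R) by [].
  apply: (@le_trans _ _ (\int[lebesgue_measure]_(x in `[0%R, (n.+1%:R : R)]) (g x)%:E)%E).
    apply: ge0_subset_integral; [exact: measurable_itv|exact: measurable_itv| | |].
    - by apply: g_measS => // x /=; rewrite !in_itv/= andbT => /andP[].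
    - by move=> x /=; rewrite in_itv/= lee_fin => /andP[/g_ge0].
    - by move=> x; rewrite /F/= !in_itv/= => /andP[x1 ->]; rewrite andbT; lra.
  have := Jy _ n0; rewrite -lee_fin; apply: le_trans.
  rewrite /J /Rintegral fineK//.
  exact: (integrable_fin_num _ (integrable_decreasing n.+1%:R)).
by rewrite FE g_inty leye_eq.
Unshelve. all: by end_near. Qed.

Lemma primitive_surj (y : R) : 0 <= y -> exists2 b, 0 <= b & J b = y.
Proof.
move=> y0; have [b b0 yb] := primitive_unbounded y.
have := @IVT _ J 0 b y b0; case.
- exact: (parameterized_integral_continuous b0 (integrable_decreasing b)).
- by rewrite primitive0 (min_l (le_trans y0 yb)) (max_r (le_trans y0 yb)) y0.
- by move=> c; rewrite in_itv/= => /andP[c0 _] <-; exists c.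
Qed.

(** The mean of [g] over [[0, k * t]] is at least [g (k * t)], which is at least its mean over
    [[k * t, t]]. This inequality becomes the scaling property of the Sobolev conjugate. *)
Lemma primitive_scale (k t : R) : 0 <= k <= 1 -> 0 <= t -> k * J t <= J (k * t).
Proof.
move=> /andP[k0 k1] t0.
have [->|tn0] := eqVneq t 0; first by rewrite mulr0 primitive0 mulr0.
have [->|kn0] := eqVneq k 0; first by rewrite mul0r mul0r primitive0.
have kt0 : 0 < k * t by rewrite mulr_gt0// lt_neqAle eq_sym ?kn0 ?tn0.
have ktt : k * t <= t by rewrite ler_piMl.
have h1 := primitive_diff_ge (lexx 0) (ltW kt0).
have h2 := primitive_diff_le kt0 ktt.
rewrite primitive0 !subr0 in h1.
have h3 : k * (J t - J (k * t)) <= k * ((t - k * t) * g (k * t)).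
  by rewrite ler_wpM2l.
have h4 : (1 - k) * ((k * t) * g (k * t)) <= (1 - k) * J (k * t).
  by rewrite ler_wpM2l// subr_ge0.
nra.
Qed.

End decreasing_integrand.

(** * The Sobolev conjugate through its inverse *)

Section sobolev_conjugate.
Variables (R : realType) (d : nat) (s : R) (M : R -> R).
Hypothesis HM : nfunction M.
Hypothesis d0 : (0 < d)%N.
Hypothesis s0 : 0 < s.
Let g := conj_integrand d s M.
Let th := s / d%:R.
Hypothesis g_int : (\int[lebesgue_measure]_(t in `[0%R, 1%R]) (g t)%:E < +oo)%E.
Hypothesis g_inty :
  (\int[lebesgue_measure]_(t in `[1%R, +oo[) (g t)%:E = +oo)%E.
Local Notation J := (sobolev_conj_inv d s M).
Local Notation F := (sobolev_conj d s M).

Let dR0 : 0 < (d%:R : R). Proof. by rewrite ltr0n. Qed.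

Let conj_integrandE t : g t = halfline_inv M t / t `^ (1 + th).
Proof. by rewrite /g /conj_integrand mulrDl divff ?gt_eqF. Qed.

Let th0 : 0 < th. Proof. exact: divr_gt0. Qed.

Let g_ge0 t : 0 <= t -> 0 <= g t.
Proof.
by move=> t0; rewrite conj_integrandE divr_ge0 ?powR_ge0// (nfunction_inv_ge0 HM).
Qed.

(** Both factors are nonincreasing on positive reals, which gives the monotonicity of the
    integrand. *)
Lemma conj_integrand_div t : 0 < t ->
  g t = (halfline_inv M t / t) * t `^ (- th).
Proof.
move=> t0; rewrite conj_integrandE powRD; last by rewrite (gt_eqF t0)// implybT.
by rewrite powRr1 ?ltW// invfM powRN mulrA.
Qed.

Let g_dec x y : 0 < x -> x <= y -> g y <= g x.
Proof.
move=> x0 xy; have y0 : 0 < y by lra.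
rewrite !conj_integrand_div// ler_pM ?powR_ge0//.
- by rewrite divr_ge0 ?(nfunction_inv_ge0 HM)// ltW.
- exact: (nfunction_inv_div HM).
- by rewrite !powRN lef_pV2 ?posrE ?powR_gt0// ge0_ler_powR ?nnegrE// ltW.
Qed.

Let g_meas : measurable_fun (`[0, +oo[%classic : set R) g.
Proof.
(* The inverse of [M] is controlled only on the half-line; precomposing with [Num.max t 0] makes it
   monotone on the whole line, hence measurable. *)
apply: (@eq_measurable_fun _ _ _ _ _
  (fun t : R => halfline_inv M (Num.max t 0) * t `^ (- (1 + th)))).
  move=> t; rewrite inE/= in_itv/= andbT => t0.
  by rewrite conj_integrandE max_l// powRN.
apply: measurable_funM.
  apply: nondecreasing_measurable => // x y xy.
  apply: (nfunction_inv_le HM); first by rewrite le_max lexx orbT.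
  by rewrite ge_max !le_max xy lexx orbT.
by apply: measurable_funS (measurable_powR (- (1 + th))).
Qed.

Lemma sobolev_conj_invK t : 0 <= t -> J (F t) = t.
Proof.
move=> t0; rewrite /sobolev_conj ger0_norm//.
exact: (halfline_invK (primitive_surj g_ge0 g_dec g_meas g_int g_inty)).
Qed.

Lemma sobolev_conj_ge0 t : 0 <= F t.
Proof.
exact: (halfline_inv_ge0 (primitive_surj g_ge0 g_dec g_meas g_int g_inty) (normr_ge0 t)).
Qed.

Lemma sobolev_conj_inv_le x y : 0 <= x -> x <= y -> J x <= J y.
Proof. exact: (primitive_le g_ge0 g_dec g_meas g_int). Qed.

Lemma sobolev_conj_norm t : F `|t| = F t.
Proof. by rewrite /sobolev_conj normr_id. Qed.

Lemma sobolev_conj_inv_ge0 x : 0 <= x -> 0 <= J x.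
Proof. by move=> x0; rewrite -(primitive0 g) sobolev_conj_inv_le. Qed.

Let N_gt0 := nfunction_inv_gt0 HM.

Lemma sobolev_conj_inv_lt x y : 0 <= x -> x < y -> J x < J y.
Proof.
move=> x0 xy; rewrite -subr_gt0.
have y0 : 0 < y by lra.
apply: (lt_le_trans _ (primitive_diff_ge g_ge0 g_dec g_meas g_int x0 (ltW xy))).
rewrite mulr_gt0 ?subr_gt0// conj_integrand_div// mulr_gt0 ?powR_gt0//.
by rewrite divr_gt0// N_gt0.
Qed.

(** [J] is strictly increasing with right inverse [F]. This equivalence turns superlevel sets of [F]
    into conditions on the explicit integral [J]. *)
Lemma sobolev_conj_le_inv t f : 0 <= f -> (f <= F t) = (J f <= `|t|).
Proof.
move=> f0; rewrite -(sobolev_conj_norm t).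
apply/idP/idP => h.
  by rewrite -(sobolev_conj_invK (normr_ge0 t)) sobolev_conj_inv_le.
rewrite leNgt; apply/negP => /(sobolev_conj_inv_lt (sobolev_conj_ge0 _)).
by rewrite sobolev_conj_invK// ltNge h.
Qed.

Lemma sobolev_conj_le x y : `|x| <= `|y| -> F x <= F y.
Proof.
move=> xy; rewrite sobolev_conj_le_inv ?sobolev_conj_ge0//.
by rewrite -(sobolev_conj_norm x) sobolev_conj_invK.
Qed.

(** The form in which convexity of [F] is used. Applying the strictly increasing [J] to the contrary
    inequality contradicts [primitive_scale]. *)
Lemma sobolev_conjZ_le k x : 0 <= k <= 1 -> F (k * x) <= k * F x.
Proof.
move=> /andP[k0 k1]; rewrite leNgt; apply/negP.
have kF : 0 <= k * F x by rewrite mulr_ge0 ?sobolev_conj_ge0.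
move=> /(sobolev_conj_inv_lt kF).
rewrite -(sobolev_conj_norm (k * x)) sobolev_conj_invK// ltNge => /negP; apply.
rewrite normrM (ger0_norm k0) -{1}(sobolev_conj_invK (normr_ge0 x)) sobolev_conj_norm.
apply: (primitive_scale g_ge0 g_dec g_meas g_int); rewrite ?k0//.
exact: sobolev_conj_ge0.
Qed.

Lemma measurable_sobolev_conj : measurable_fun setT F.
Proof.
apply: (@eq_measurable_fun _ _ _ _ _ ((fun t => F (Num.max t 0)) \o (fun t : R => `|t|))).
  by move=> t _ /=; rewrite max_l// sobolev_conj_norm.
apply: measurableT_comp; last exact: normr_measurable.
apply: nondecreasing_measurable => // x y xy.
have m0 (z : R) : 0 <= Num.max z 0 by rewrite le_max lexx orbT.
apply: sobolev_conj_le; rewrite !ger0_norm//.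
by rewrite ge_max !le_max xy lexx orbT.
Qed.

(** On [[f / 2, f]], of length [f / 2], the integrand is at least its value at [f]. This is the drop
    of [J] between two consecutive dyadic levels. *)
Lemma sobolev_conj_inv_half f : 0 < f ->
  halfline_inv M f * f `^ (- th) / 2 <= J f - J (f / 2).
Proof.
move=> f0; have := primitive_diff_ge g_ge0 g_dec g_meas g_int.
have f2 : 0 <= f / 2 by lra. have ff : f / 2 <= f by lra.
move=> /(_ _ _ f2 ff); apply: le_trans.
rewrite conj_integrand_div//.
have -> : f - f / 2 = f / 2 by lra.
have -> : f / 2 * (halfline_inv M f / f * f `^ (- th)) =
  (f / f) * (halfline_inv M f * f `^ (- th) / 2) by ring.
by rewrite divff ?gt_eqF// mul1r.
Qed.

End sobolev_conjugate.

(** * Cubes, grids and Lebesgue measure on row vectors *)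

Section cubes.
Variables (R : realType).

(** Half-open, with lower corner [a], so that the cells of a grid are disjoint and cover the
    space. *)
Definition cube d (a : 'rV[R]_d) (h : R) : set 'rV[R]_d :=
  [set x | forall i, a ord0 i <= x ord0 i < a ord0 i + h].

Lemma measurable_coordinates d (A : 'I_d -> set R) :
  (forall i, measurable (A i)) ->
  measurable [set x : 'rV[R]_d | forall i, A i (x ord0 i)].
Proof.
move=> mA.
(* The intersection is indexed by all natural numbers; an index at least [d] imposes no
   condition. *)
rewrite (_ : [set x | _] = \bigcap_k [set x : 'rV[R]_d |
    forall i : 'I_d, i = k :> nat -> A i (x ord0 i)]); last first.
  by apply/seteqP; split => [x xA k _ i _|x xA i]; [exact: xA|exact: (xA i)].
apply: bigcapT_measurable => k; have [kd|dk] := ltnP k d; last first.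
  rewrite (_ : [set x | _] = setT)//; apply/seteqP; split => // x _ i ik.
  by have := ltn_ord i; rewrite ik ltnNge dk.
rewrite (_ : [set x | _] =
    (fun x : 'rV[R]_d => x ord0 (Ordinal kd)) @^-1` A (Ordinal kd)).
  rewrite -[X in measurable X]setTI.
  exact: (@measurable_coord R d (Ordinal kd) measurableT _ (mA _)).
apply/seteqP; split => x /= xA; first exact: xA.
by move=> i ik; have -> : i = Ordinal kd by exact: val_inj.
Qed.

Lemma measurable_cube d (a : 'rV[R]_d) h : measurable (cube a h).
Proof.
exact: (@measurable_coordinates d
  (fun i => `[a ord0 i, a ord0 i + h[%classic) (fun=> measurable_itv _)).
Qed.

(** Induction along the construction of the measure: through [rV_cons] a cube is the product of an
    interval and a cube of one dimension less. In dimension 0 the Dirac mass gives [1 = h ^+ 0]. *)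
Lemma lebesgue_cube d (a : 'rV[R]_d) (h : R) : 0 <= h ->
  lebesgue_rV d (cube a h) = (h ^+ d)%:E.
Proof.
move=> h0; elim: d a => [|d IH] a.
  by rewrite /= diracE expr0 mem_set// => -[].
transitivity ((@lebesgue_measure R \x lebesgue_rV d)%E (@rV_cons R d @^-1` cube a h)).
  by [].
have -> : @rV_cons R d @^-1` cube a h =
    `[a ord0 ord0, a ord0 ord0 + h[%classic `*` cube (\row_j a ord0 (lift ord0 j)) h.
  apply/seteqP; split => [p pa|p [p1 p2] i].
    split; first by have := pa ord0; rewrite rV_cons0/= in_itv.
    by move=> j; have := pa (lift ord0 j); rewrite rV_consS mxE.
  have [j ->|->] := unliftP ord0 i.
    by rewrite rV_consS; have := p2 j; rewrite mxE.
  by rewrite rV_cons0; move: p1; rewrite /= in_itv.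
rewrite product_measure1E//; last exact: measurable_cube.
rewrite IH exprS EFinM; congr (_ * _)%E.
transitivity (lebesgue_measure (`[a ord0 ord0, a ord0 ord0 + h[%classic : set R)).
  by [].
rewrite lebesgue_measure_itv/= lte_fin ltrDl.
case: ltP => h0'; first by rewrite -EFinB addrAC subrr add0r.
by congr EFin; apply/eqP; rewrite eq_le h0 h0'.
Qed.

(** For nonnegative [r], the closed ball of the max norm, in coordinates. *)
Definition box d (x : 'rV[R]_d) (r : R) : set 'rV[R]_d :=
  [set y | forall i, `|y ord0 i - x ord0 i| <= r].

Lemma measurable_box d (x : 'rV[R]_d) r : measurable (box x r).
Proof.
have := @measurable_coordinates d
  (fun i => `[x ord0 i - r, x ord0 i + r]%classic) (fun=> measurable_itv _).
rewrite (_ : [set _ | _] = box x r)//; apply/seteqP.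
by split => y yx i; have := yx i; rewrite /= in_itv/= ler_distl.
Qed.

Lemma nbhs_box d (x : 'rV[R]_d) (U : set 'rV[R]_d) :
  nbhs x U -> exists2 e, 0 < e & box x e `<=` U.
Proof.
move=> /nbhs_ballP[e e0 eU]; exists (e / 2); first exact: divr_gt0.
move=> y xy; apply: eU; split => // i j; rewrite (ord1 i).
rewrite -ball_normE/= distrC; apply: le_lt_trans (xy j) _.
by rewrite ltr_pdivrMr// mulr_natr mulr2n ltrDl.
Qed.

Lemma box_nbhs d (x : 'rV[R]_d) (e : R) : 0 < e -> nbhs x (box x e).
Proof.
move=> e0; apply/nbhs_ballP; exists e => // y [_ xy] i.
by have := xy ord0 i; rewrite -ball_normE/= distrC => /ltW.
Qed.

Lemma cube_box d (a x : 'rV[R]_d) h : cube a h x -> cube a h `<=` box x h.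
Proof.
move=> xa y ya i; have /andP[x1 x2] := xa i; have /andP[y1 y2] := ya i.
by rewrite ler_norml; apply/andP; split; lra.
Qed.

Definition cell d (h : R) (z : 'rV[int]_d) : set 'rV[R]_d :=
  cube (\row_i (h * (z ord0 i)%:~R)) h.

Lemma cell_cover d (h : R) (x : 'rV[R]_d) : 0 < h -> exists z, cell h z x.
Proof.
move=> h0; exists (\row_i Num.floor (x ord0 i / h)) => i; rewrite !mxE.
have /andP[f1 f2] := floor_itv (x ord0 i / h).
rewrite mulrC -ler_pdivlMr// f1/= -[X in _ < _ + X]mul1r -mulrDl -ltr_pdivrMr//.
by move: f2; rewrite intrD.
Qed.

Lemma cell_eq d (h : R) (x : 'rV[R]_d) z z' : 0 < h ->
  cell h z x -> cell h z' x -> z = z'.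
Proof.
move=> h0 xz xz'; apply/rowP => i.
have fE w : cell h w x -> Num.floor (x ord0 i / h) = w ord0 i.
  move=> /(_ i); rewrite !mxE => /andP[w1 w2].
  apply: floor_def; rewrite ler_pdivlMr// mulrC w1/= ltr_pdivrMr//.
  by rewrite intrD mulrDl mulrC mul1r.
by rewrite -(fE _ xz) -(fE _ xz').
Qed.

(** The sigma-algebra is generated by the coordinates, so openness has to be linked to it: [U] is
    the countable union of the grid cells of mesh [1 / (n + 1)] contained in it. *)
Lemma open_measurable_rV d (U : set 'rV[R]_d) : open U -> measurable U.
Proof.
move=> oU.
have -> : U = \bigcup_(n : nat) \bigcup_(z : 'rV[int]_d)
    (if `[< cell (n.+1%:R^-1) z `<=` U >] then cell (n.+1%:R^-1) z else set0).
  apply/seteqP; split => [x Ux|x [n _ [z _]]]; last first.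
    by case: asboolP => // zU; exact: zU.
  have [e e0 eU] := nbhs_box (open_nbhs_nbhs (conj oU Ux)).
  have [n ne] : exists n : nat, n.+1%:R^-1 <= e.
    exists (Num.trunc e^-1); rewrite invf_ple ?posrE//.
    exact/ltW/truncnS_gt.
  have n0 : 0 < n.+1%:R^-1 :> R by rewrite invr_gt0.
  exists n => //; have [z zx] := cell_cover x n0; exists z => //.
  case: asboolP => // -[]; apply: subset_trans eU.
  by apply: subset_trans (cube_box zx) _ => y yx i; exact: le_trans (yx i) ne.
apply: bigcupT_measurable => n; apply: countable_bigcupT_measurable.
  exact: countableP.
by move=> z; case: ifP => // _; exact: measurable_cube.
Qed.

Lemma bounded_box d (U : set 'rV[R]_d) : bounded_set U ->
  exists2 K, 0 < K & U `<=` box 0 K.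
Proof.
move=> [K0 [_ /(_ (Num.max K0 0 + 1))]].
have K1 : 0 < Num.max K0 0 + 1 by rewrite ltr_pwDr// le_max lexx orbT.
have K2 : K0 < Num.max K0 0 + 1 by rewrite ltr_pwDr// le_max lexx.
move=> /(_ K2) UK; exists (Num.max K0 0 + 1) => // x Ux i.
apply: le_trans (UK x Ux); rewrite mxE subr0.
rewrite [leRHS]/Num.norm/= mx_normrE.
by apply: (le_trans _ (le_bigmax _ _ (ord0, i))).
Qed.

Lemma bounded_lebesgue_lty d (U : set 'rV[R]_d) : measurable U ->
  bounded_set U -> (lebesgue_rV d U < +oo)%E.
Proof.
move=> mU /bounded_box[K K0 UK].
(* The extra 1 in the side lets a half-open cube contain the closed box of radius [K]. *)
apply: (@le_lt_trans _ _ (lebesgue_rV d (cube (const_mx (- K)) (2 * K + 1)))).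
  apply: le_measure; rewrite ?inE//; first exact: measurable_cube.
  move=> x /UK xK i; have := xK i; rewrite !mxE subr0 ler_norml => /andP[k1 k2].
  by apply/andP; split; lra.
by rewrite lebesgue_cube ?ltry//; lra.
Qed.

End cubes.

(** * The Euclidean norm *)

Section euclidean_norm.
Variables (R : realType).

Lemma enorm_ge0 d (x : 'rV[R]_d) : 0 <= enorm x.
Proof. exact: sqrtr_ge0. Qed.

Lemma coord_le_enorm d (x : 'rV[R]_d) i : `|x ord0 i| <= enorm x.
Proof.
rewrite -sqrtr_sqr; apply: ler_wsqrtr; rewrite (bigD1 i)//= lerDl.
by apply: sumr_ge0 => j _; exact: sqr_ge0.
Qed.

Lemma enorm_le d (x : 'rV[R]_d) r : 0 <= r ->
  (forall i, `|x ord0 i| <= r) -> enorm x <= d%:R * r.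
Proof.
move=> r0 xr; have dr : 0 <= d%:R * r by rewrite mulr_ge0.
rewrite -(ger0_norm dr) -sqrtr_sqr; apply: ler_wsqrtr.
apply: (@le_trans _ _ (\sum_(i < d) r ^+ 2)).
  apply: ler_sum => i _; rewrite -(real_normK (num_real (x ord0 i))).
  by rewrite ler_sqr ?nnegrE.
rewrite sumr_const card_ord -[leLHS]mulr_natl exprMn ler_wpM2r ?sqr_ge0//.
by rewrite -natrX ler_nat; case: d {x xr dr} => // d; rewrite leq_pmulr.
Qed.

Lemma enorm_mulmx d (x : 'rV[R]_d) (Q : 'M[R]_d) : Q *m Q^T = 1%:M ->
  enorm (x *m Q) = enorm x.
Proof.
have E (y : 'rV[R]_d) : \sum_(i < d) y ord0 i ^+ 2 = (y *m y^T) ord0 ord0.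
  by rewrite mxE; apply: eq_bigr => i _; rewrite mxE expr2.
move=> QQ; rewrite /enorm !E trmx_mul mulmxA -(mulmxA x) QQ mulmx1.
by [].
Qed.

Lemma measurable_enorm d : measurable_fun setT (@enorm R d).
Proof.
rewrite /enorm.
apply: (@measurableT_comp _ _ _ _ _ _ (@Num.sqrt R)).
  by apply: continuous_measurable_fun; exact: sqrt_continuous.
apply: measurable_sum => i.
exact: (measurable_funX 2 (@measurable_coord R d i)).
Qed.

End euclidean_norm.

(** * Measure density of Lipschitz domains *)

Section measure_density.
Variables (R : realType) (d : nat).
Hypothesis d0 : (0 < d)%N.

(** The constant [del] is both the largest scale allowed and the ratio of the side of the cube to
    [r]; a single parameter suits a compactness argument along the filter of small positive reals.
    The premise [Omega x] lets the property be stated near boundary points. *)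
Definition corkscrew (Omega : set 'rV[R]_d) (del : R) (x : 'rV[R]_d) : Prop :=
  Omega x -> forall r, 0 < r -> r <= del ->
    exists z, cube z (del * r) `<=` Omega `&` box x r.

Let dR0 : 1 <= (d%:R : R). Proof. by rewrite ler1n. Qed.

(** The cube with lower corner [x] works as soon as [x] is within [e / 2] of [x0] and [r] is at most
    [e / 2]. *)
Lemma corkscrew_interior (Omega : set 'rV[R]_d) (x0 : 'rV[R]_d) :
  nbhs x0 Omega -> \forall x \near x0 & del \near 0^'+, corkscrew Omega del x.
Proof.
move=> /nbhs_box[e e0 eO].
near=> x del => /= Ox r r0 rdel; exists x => y /= yx.
have del1 : del <= 1 by near: del; apply: nbhs_right_le.
have dele : del <= e / 2 by near: del; apply: nbhs_right_le; exact: divr_gt0.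
have delr : del * r <= r by rewrite ler_piMl// ltW.
have yb : box x r y.
  move=> i; have /= /andP[y1 y2] := yx i.
  by rewrite ler_norml; apply/andP; split; lra.
split=> //; apply: eO => i.
have xe : box x0 (e / 2) x by near: x; apply: box_nbhs; exact: divr_gt0.
rewrite -(subrKA (x ord0 i)); apply: (le_trans (ler_normD _ _)).
have := yb i; have := xe i; lra.
Unshelve. all: by end_near. Qed.

(** From [x] above the graph, moving up by [t = r / 2] gains height [t]. A further displacement of
    size [eps * t] in each original coordinate changes the height above the graph by at most
    [t / 2], so a whole small cube stays in [Omega]. *)
Lemma corkscrew_graph (Omega : set 'rV[R]_d) (x0 : 'rV[R]_d) (Q : 'M[R]_d)
    (i : 'I_d) (gamma : 'rV[R]_d.-1 -> R) (L rho : R) :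
  Q *m Q^T = 1%:M -> 0 < rho ->
  (forall y z, `|gamma y - gamma z| <= L * enorm (y - z)) ->
  (forall x, enorm (x - x0) < rho ->
    (Omega x <-> gamma (col' i (x *m Q)) < (x *m Q) ord0 i)) ->
  \forall x \near x0 & del \near 0^'+, corkscrew Omega del x.
Proof.
move=> QQ rho0 lip graph.
have [K K2 KL] : exists2 K : R, 2 <= K & `|L| + 2 <= K.
  by exists (`|L| + 2) => //; rewrite lerDr.
have [D D1 DE] : exists2 D : R, 1 <= D & d%:R = D by exists d%:R.
have D0 : 0 < D by lra.
have KD : 4 <= 2 * K * D ^+ 2 by nra.
(* Chosen so that [K * D ^+ 2 * eps = 1 / 2]. One factor [D] passes from coordinates of the
   displacement to its Euclidean norm, the other does so again after the rotation. *)
pose eps := (2 * K * D ^+ 2)^-1.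
have eps0 : 0 < eps by rewrite invr_gt0; lra.
have epsE : K * D ^+ 2 * eps = 2^-1.
  have K0 : 0 < K by lra.
  by rewrite /eps; field; rewrite !gt_eqF.
near=> x del => /= Ox r r0 rdel.
have dele : del <= eps / 2 by near: del; apply: nbhs_right_le; exact: divr_gt0.
have del2 : D * del <= rho / 4.
  rewrite mulrC -ler_pdivlMr; last lra.
  by near: del; apply: nbhs_right_le; rewrite divr_gt0 ?divr_gt0//; lra.
have xx0 : box x0 (rho / (4 * D)) x.
  by near: x; apply: box_nbhs; rewrite divr_gt0//; lra.
pose t := r / 2; have t0 : 0 < t by rewrite divr_gt0.
(* The vertical unit vector of the rotated frame; [e *m Q^T] is the same direction in the original
   coordinates. *)
pose e : 'rV[R]_d := delta_mx ord0 i.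
have eQ : e *m Q^T *m Q = e.
  by rewrite -mulmxA (mulmx1C QQ) mulmx1.
have eQ1 j : `|(e *m Q^T) ord0 j| <= 1.
  apply: le_trans (coord_le_enorm _ _) _.
  rewrite enorm_mulmx ?trmxK ?(mulmx1C QQ)//.
  rewrite /enorm (bigD1 i)//= big1 ?addr0.
    by rewrite mxE !eqxx expr1n sqrtr1.
  by move=> k ki; rewrite mxE eqxx (negbTE ki) expr0n.
exists (x + t *: (e *m Q^T)) => y /= yz.
pose v := y - x - t *: (e *m Q^T).
have vE : y = x + t *: (e *m Q^T) + v.
  by apply/rowP => j; rewrite /v !mxE; ring.
have epst : del * r <= eps * t.
  rewrite /t mulrA mulrAC ler_wpM2r// ltW//.
have vj j : `|v ord0 j| <= eps * t.
  have /andP[] := yz j; rewrite /v !mxE.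
  move=> y1 y2; rewrite ler_norml; apply/andP; split; lra.
have eps1 : eps <= 1 / 4.
  by rewrite /eps div1r lef_pV2 ?posrE//; lra.
have epst0 : 0 <= eps * t by rewrite mulr_ge0// ltW.
have yxr : box x r y.
  move=> j; have -> : y ord0 j - x ord0 j = t * (e *m Q^T) ord0 j + v ord0 j.
    by rewrite {1}vE !mxE; ring.
  apply: (le_trans (ler_normD _ _)); rewrite normrM (gtr0_norm t0).
  have h1 : t * `|(e *m Q^T) ord0 j| <= t by rewrite ler_piMr// ltW.
  have h2 := vj j.
  have h3 : eps * t <= 1 * t by rewrite ler_wpM2r//; lra.
  have : r = t + t by rewrite /t; lra.
  lra.
split=> //.
(* Both [x] and [y] stay in the ball of radius [rho] where the graph description is valid. *)
have near_x0 (z : 'rV[R]_d) : (forall j, `|z ord0 j - x0 ord0 j| <= del + rho / (4 * D)) ->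
    enorm (z - x0) < rho.
  move=> zx0; have h : 0 <= del + rho / (4 * D).
    by rewrite addr_ge0 ?divr_ge0//; lra.
  apply: (le_lt_trans (enorm_le h _)); first by move=> j; rewrite !mxE.
  have -> : d%:R * (del + rho / (4 * D)) = D * del + rho / 4.
    by rewrite DE; field; rewrite gt_eqF.
  lra.
have del0 : 0 < del by lra.
have yx0 : enorm (y - x0) < rho.
  apply: near_x0 => j; rewrite -(subrKA (x ord0 j)).
  apply: (le_trans (ler_normD _ _)); apply: lerD (xx0 j).
  exact: le_trans (yxr j) rdel.
have x0x : enorm (x - x0) < rho.
  by apply: near_x0 => j; apply: (le_trans (xx0 j)); rewrite lerDr ltW.
apply/(graph y yx0); have /(graph x x0x) gx := Ox.
have yQE : y *m Q = x *m Q + t *: e + v *m Q.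
  by rewrite vE !mulmxDl -scalemxAl eQ.
have vQ k : `|(v *m Q) ord0 k| <= D * (eps * t).
  apply: le_trans (coord_le_enorm _ _) _; rewrite enorm_mulmx// -DE.
  exact: enorm_le.
have b0 : 0 <= D * (eps * t) by rewrite mulr_ge0// ltW.
(* The vertical move does not affect the remaining coordinates, so only [v *m Q] contributes. *)
have en : enorm (col' i (y *m Q) - col' i (x *m Q)) <= D * (D * (eps * t)).
  apply: (le_trans (enorm_le b0 _)).
    move=> k; rewrite yQE; have := vQ (lift i k); congr (`|_| <= _).
    rewrite !mxE eqxx/= (eq_sym _ i) (negbTE (neq_lift _ _)) mulr0 addr0.
    by rewrite addrC addKr.
  by rewrite ler_wpM2r// -DE ler_nat leq_pred.
have := lip (col' i (y *m Q)) (col' i (x *m Q)).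
rewrite ler_norml => /andP[_ gy].
have yi : (y *m Q) ord0 i = (x *m Q) ord0 i + t + (v *m Q) ord0 i.
  by rewrite yQE !mxE !eqxx mulr1.
rewrite yi.
have := vQ i; rewrite ler_norml => /andP[vi _].
have LL : L * enorm (col' i (y *m Q) - col' i (x *m Q)) <=
    `|L| * (D * (D * (eps * t))).
  apply: (@le_trans _ _ (`|L| * enorm (col' i (y *m Q) - col' i (x *m Q)))).
    by rewrite ler_wpM2r ?enorm_ge0 ?ler_norm.
  by rewrite ler_wpM2l.
have bD : D * (eps * t) <= D * (D * (eps * t)) by rewrite ler_peMl.
have h : (`|L| + 1) * (D * (D * (eps * t))) <= t / 2.
  have -> : t / 2 = K * (D * (D * (eps * t))).
    by rewrite -epsE; ring.
  rewrite ler_wpM2r//; last lra.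
  by rewrite mulr_ge0// ltW.
lra.
Unshelve. all: by end_near. Qed.

(** Each point of the compact set [closure Omega] has a neighbourhood on which all small [del] work;
    compactness makes the threshold uniform. *)
Lemma C01_corkscrew (Omega : set 'rV[R]_d) :
  open Omega -> bounded_set Omega -> C01_regular Omega ->
  exists2 del, 0 < del & forall x, corkscrew Omega del x.
Proof.
move=> oO bO cO.
have cptO : compact (closure Omega).
  apply: bounded_closed_compact; last exact: closed_closure.
  have [K K0 OK] := bounded_box bO.
  exists (K + 1); split; first exact: num_real.
  move=> r Kr x /(_ (box x 1) (box_nbhs _ ltr01))[y [/OK Oy xy]].
  rewrite /= [leLHS]/Num.norm/= mx_normrE.
  apply: bigmax_le => [|[i j] _ /=]; first by lra.
  rewrite (ord1 i).
  have := Oy j; have := xy j; rewrite mxE subr0 => h1 h2.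
  have -> : x ord0 j = y ord0 j - (y ord0 j - x ord0 j) by lra.
  apply: (le_trans (ler_normB _ _)); lra.
have cov := (compact_near_coveringP _).1 cptO _ (0^'+ : set_system R)
  (fun del x => corkscrew Omega del x).
have {cov} cov : \forall del \near 0^'+, closure Omega `<=` corkscrew Omega del.
  (* A point of the closure that is not interior is a boundary point, where the Lipschitz graph is
     available. *)
  apply: cov => x0 Ox0; have [iO|niO] := pselect (interior Omega x0).
    exact: corkscrew_interior.
  have [Q [i [gamma [L [rho [QQ rho0 lip graph]]]]]] := cO x0 (conj Ox0 niO).
  exact: (corkscrew_graph QQ rho0 lip graph).
near ((0 : R)^'+) => del; exists del; first by [].
move=> x Ox.
have : closure Omega `<=` corkscrew Omega del by near: del.
by move=> /(_ x (subset_closure Ox)) /(_ Ox).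
Unshelve. all: by end_near. Qed.

Lemma corkscrew_density (Omega : set 'rV[R]_d) del : 0 < del -> open Omega ->
  (forall x, corkscrew Omega del x) ->
  forall x r, Omega x -> 0 < r -> r <= del ->
  (((del * r) ^+ d)%:E <= lebesgue_rV d (Omega `&` box x r))%E.
Proof.
move=> del0 oO cO x r Ox r0 rdel; have [z zO] := cO x Ox r r0 rdel.
rewrite -(lebesgue_cube z); last by rewrite mulr_ge0// ltW.
apply: le_measure; rewrite ?inE//; first exact: measurable_cube.
apply: measurableI; first exact: open_measurable_rV.
exact: measurable_box.
Qed.

End measure_density.

Section integral_lower_bound.
Context {dd : measure_display} {T : measurableType dd} {R : realType}.
Variable mu : {measure set T -> \bar R}.

(** Markov's inequality, with a set [A] on which the lower bound is known in place of a superlevel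
    set. *)
Lemma integral_ge_measure (D A : set T) (f : T -> \bar R) (c : R) :
  measurable D -> measurable A -> A `<=` D -> measurable_fun D f ->
  (forall x, D x -> 0 <= f x)%E -> (forall x, A x -> c%:E <= f x)%E -> 0 <= c ->
  (c%:E * mu A <= \int[mu]_(x in D) f x)%E.
Proof.
move=> mD mA AD mf f0 cf c0; rewrite -integral_cst//.
apply: (@le_trans _ _ (\int[mu]_(x in A) f x)%E).
  apply: ge0_le_integral => //.
  by exact: measurable_funS mf.
exact: ge0_subset_integral.
Qed.

End integral_lower_bound.

(** * The modular estimate and the continuous embedding *)

Section gagliardo_kernel.
Variables (R : realType) (d : nat) (s : R) (M : R -> R).
Hypothesis HM : nfunction M.

Definition gagliardo_kernel (u : 'rV[R]_d -> R) (x y : 'rV[R]_d) : R :=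
  M ((u x - u y) / enorm (x - y) `^ s) / enorm (x - y) ^+ d.

Lemma gagliardo_kernel_ge0 u x y : 0 <= gagliardo_kernel u x y.
Proof. by rewrite divr_ge0 ?(nfunction_ge0 HM)// exprn_ge0 ?enorm_ge0. Qed.

(** Arbitrary measurable [X] and [Y] cover both the kernel with one variable fixed and the kernel on
    the product space. *)
Lemma measurable_gagliardo_kernel dd (T : measurableType dd)
    (X Y : T -> 'rV[R]_d) (u : 'rV[R]_d -> R) :
  measurable_fun setT X -> measurable_fun setT Y -> measurable_fun setT u ->
  measurable_fun setT (fun t => gagliardo_kernel u (X t) (Y t)).
Proof.
move=> mX mY mu.
have mE : measurable_fun setT (fun t => enorm (X t - Y t)).
  apply: (measurableT_comp (@measurable_enorm R d)).
  apply: measurable_fun_rVP => i.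
  under eq_fun do rewrite !mxE.
  apply: measurable_funB; apply: (measurableT_comp (@measurable_coord R d i)) => //.
(* Quotients become products with real powers of negative exponent, which are measurable
   functions. *)
rewrite (_ : (fun t => _) = (fun t =>
    M ((u (X t) - u (Y t)) * enorm (X t - Y t) `^ (- s)) *
    enorm (X t - Y t) `^ (- d%:R))); last first.
  apply/funext => t; rewrite /gagliardo_kernel !powRN.
  by rewrite powR_mulrn ?enorm_ge0.
apply: measurable_funM; last first.
  exact: (measurableT_comp (measurable_powR (- d%:R)) mE).
apply: (measurableT_comp (continuous_measurable_fun (@nfunction_continuous _ _ HM))).
apply: measurable_funM; last first.
  exact: (measurableT_comp (measurable_powR (- s)) mE).
by apply: measurable_funB; apply: (measurableT_comp mu).
Qed.

Variable Omega : set 'rV[R]_d.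
Hypothesis mO : measurable Omega.
Local Notation mu := (lebesgue_rV d).

Definition gagliardo_density (u : 'rV[R]_d -> R) (x : 'rV[R]_d) : \bar R :=
  (\int[mu]_(y in Omega) (gagliardo_kernel u x y)%:E)%E.

Lemma gagliardo_density_ge0 u x : (0 <= gagliardo_density u x)%E.
Proof. by apply: integral_ge0 => y _; rewrite lee_fin gagliardo_kernel_ge0. Qed.

Let patch_eq (u : 'rV[R]_d -> R) x : Omega x -> (u \_ Omega) x = u x.
Proof. by move=> Ox; rewrite patchE mem_set. Qed.

Lemma measurable_gagliardo_kernelr (u : 'rV[R]_d -> R) x : Omega x ->
  measurable_fun Omega u -> measurable_fun Omega (gagliardo_kernel u x).
Proof.
move=> Ox /(measurable_restrictT _ mO) mu.
apply: (@eq_measurable_fun _ _ _ _ _ (gagliardo_kernel (u \_ Omega) x)).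
  by move=> y; rewrite inE => Oy; rewrite /gagliardo_kernel !patch_eq.
apply: measurable_funTS.
exact: (@measurable_gagliardo_kernel _ _ (cst x) id).
Qed.

(** Tonelli on the whole product space: [u] is extended by 0 outside [Omega], and an indicator in
    the second variable restores the domain of the inner integral. *)
Lemma measurable_gagliardo_density (u : 'rV[R]_d -> R) :
  measurable_fun Omega u -> measurable_fun Omega (gagliardo_density u).
Proof.
move=> /(measurable_restrictT _ mO) mu.
pose f (p : 'rV[R]_d * 'rV[R]_d) : \bar R :=
  (gagliardo_kernel (u \_ Omega) p.1 p.2 * \1_Omega p.2)%:E.
apply: (@eq_measurable_fun _ _ _ _ _ (fubini_F (lebesgue_rV d) f)).
  move=> x; rewrite inE => Ox; rewrite /fubini_F /gagliardo_density.
  rewrite [RHS]integral_mkcond; apply: eq_integral => y _.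
  rewrite /f/= patchE indicE; case: ifPn => Oy; last by rewrite mulr0.
  by rewrite mulr1 /gagliardo_kernel !patch_eq//; rewrite inE in Oy.
apply: measurable_funTS; apply: measurable_fun_fubini_tonelli_F.
  apply/measurable_EFinP; apply: measurable_funM.
    exact: measurable_gagliardo_kernel.
  apply: (measurableT_comp _ measurable_snd); exact: measurable_indic.
by move=> p; rewrite lee_fin mulr_ge0 ?gagliardo_kernel_ge0.
Qed.

End gagliardo_kernel.

(** * The modular estimate for the Sobolev conjugate *)

Section sobolev_modular_estimate.
Variables (R : realType) (d : nat) (s : R) (M : R -> R) (Omega : set 'rV[R]_d).
Hypothesis d0 : (0 < d)%N.
Hypothesis s0 : 0 < s.
Hypothesis HM : nfunction M.
Hypothesis g_int : (\int[lebesgue_measure]_(t in `[0%R, 1%R])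
  (conj_integrand d s M t)%:E < +oo)%E.
Hypothesis g_inty : (\int[lebesgue_measure]_(t in `[1%R, +oo[)
  (conj_integrand d s M t)%:E = +oo)%E.
Hypothesis mO : measurable Omega.
Local Notation mu := (lebesgue_rV d).
Hypothesis Ofin : (mu Omega < +oo)%E.
Variable del : R.
Hypothesis del0 : 0 < del.
Hypothesis density : forall x r, Omega x -> 0 < r -> r <= del ->
  (((del * r) ^+ d)%:E <= mu (Omega `&` box x r))%E.

Local Notation J := (sobolev_conj_inv d s M).
Local Notation F := (sobolev_conj d s M).
Local Notation N := (halfline_inv M).
Let th := s / d%:R.
Let F_le_inv := sobolev_conj_le_inv HM d0 s0 g_int g_inty.
Let F_ge0 := sobolev_conj_ge0 HM d0 s0 g_int g_inty.
Let J_half := sobolev_conj_inv_half HM d0 s0 g_int.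
Let mF := measurable_sobolev_conj HM d0 s0 g_int g_inty.
Let dR0 : 0 < (d%:R : R). Proof. by rewrite ltr0n. Qed.
Let th0 : 0 < th. Proof. exact: divr_gt0. Qed.

Let superlevel (u : 'rV[R]_d -> R) (lam f : R) : set 'rV[R]_d :=
  Omega `&` [set x | f <= F (lam * u x)].

Let measurable_superlevel (u : 'rV[R]_d -> R) lam f : measurable_fun Omega u ->
  measurable (superlevel u lam f).
Proof.
move=> mu; apply: measurable_fun_le => //.
apply: (measurableT_comp mF); exact: measurable_funM.
Qed.

(** With this value, the radius [r] given by [(del * r) ^+ d = 4 * kap / f] is at most [del]
    whenever [f >= 2]. *)
Let kap : R := del ^+ (2 * d) / 2.
Let kap0 : 0 < kap. Proof. by rewrite divr_gt0// exprn_gt0. Qed.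
(** Converts [(del * r) ^+ d] into [(d%:R * r) ^+ d], where [d%:R * r] bounds Euclidean distances to
    the centre of a box of radius [r]. *)
Let a : R := (d%:R / del) ^+ d.
Let a0 : 0 < a. Proof. by rewrite exprn_gt0// divr_gt0. Qed.
Let C1 : R := (4 * a * kap) `^ (- th) / 2.
Let C1_gt0 : 0 < C1.
Proof. by rewrite divr_gt0// powR_gt0// mulr_gt0// mulr_gt0. Qed.
Let c2 : R := C1 / (2 * a).
Let c2_gt0 : 0 < c2. Proof. by rewrite divr_gt0// mulr_gt0. Qed.

(* At most half of the ball of volume 4 kap / f around x meets {F(lam u) >= f/2};
   on the other half u drops by (J f - J (f/2)) / lam >= N f * f^-th / (2 lam). *)
Lemma gagliardo_density_ge (u : 'rV[R]_d -> R) lam f x :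
  measurable_fun Omega u -> 0 < lam -> lam <= C1 -> 2 <= f ->
  (mu (superlevel u lam (f / 2)) <= (2 * kap / f)%:E)%E ->
  superlevel u lam f x ->
  ((c2 / lam * f)%:E <= gagliardo_density s M Omega u x)%E.
Proof.
move=> mu_ lam0 lamC f2 Af [Ox Fx].
have f0 : 0 < f by lra.
pose r := (4 * kap / f) `^ (d%:R)^-1 / del.
have q0 : 0 < 4 * kap / f by rewrite divr_gt0// mulr_gt0.
have r0 : 0 < r by rewrite divr_gt0// powR_gt0.
have drE : (del * r) ^+ d = 4 * kap / f.
  rewrite /r mulrC divfK ?gt_eqF// -powR_mulrn ?powR_ge0// -powRrM.
  by rewrite mulVf ?gt_eqF// powRr1// ltW.
have rdel : r <= del.
  rewrite -(ler_pM2l del0) -expr2.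
  have dr0 : 0 <= del * r by rewrite mulr_ge0// ltW.
  have d20 : 0 <= del ^+ 2 by rewrite sqr_ge0.
  rewrite -(ler_pXn2r d0)// drE -exprM ler_pdivrMr//.
  have -> : 4 * kap = del ^+ (2 * d) * 2 by rewrite /kap; field.
  by rewrite ler_wpM2l// exprn_ge0// ltW.
pose rho := d%:R * r; have rho0 : 0 < rho by rewrite mulr_gt0.
have rhodE : rho ^+ d = 4 * a * kap / f.
  have -> : rho = d%:R / del * (del * r) by rewrite /rho; field; rewrite gt_eqF.
  by rewrite exprMn drE /a; ring.
have rhos : rho `^ s = (4 * a * kap) `^ th * f `^ (- th).
  have -> : s = d%:R * th by rewrite /th mulrCA divff ?mulr1// gt_eqF.
  rewrite powRrM powR_mulrn ?ltW// rhodE powRM ?invr_ge0 ?ltW//; last first.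
    by rewrite mulr_gt0// mulr_gt0.
  by rewrite -(powR_inv1 (ltW f0)) -powRrM mulN1r.
(* The box part has measure at least [4 * kap / f] and the level set at most half of that, so [Y]
   keeps measure [2 * kap / f]. *)
pose Y := (Omega `&` box x r) `\` superlevel u lam (f / 2).
have mS := measurable_superlevel lam (f / 2) mu_.
have mB : measurable (Omega `&` box x r) by apply: measurableI => //;
    exact: measurable_box.
have mY : measurable Y by exact: measurableD.
have Yge : ((2 * kap / f)%:E <= mu Y)%E.
  have h1 := density Ox r0 rdel; rewrite drE in h1.
  have h2 := measureDI mu mB mS.
  have h3 : (mu ((Omega `&` box x r) `&` superlevel u lam (f / 2)) <= (2 * kap / f)%:E)%E.
    by apply: le_trans Af; exact: measureIr.
  have h4 : ((4 * kap / f)%:E <= mu Y + (2 * kap / f)%:E)%E.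
    by apply: (le_trans h1); rewrite h2 leeD2l.
  rewrite -leeBlDr// -EFinB in h4; apply: le_trans h4.
  by rewrite lee_fin le_eqVlt; apply/orP; left; apply/eqP; field; rewrite gt_eqF.
have ak0 : 0 < 4 * a * kap by apply: mulr_gt0 kap0; exact: mulr_gt0 a0.
have flC : 0 <= f / lam * C1 := mulr_ge0 (divr_ge0 (ltW f0) (ltW lam0)) (ltW C1_gt0).
have kerY y : Y y -> (f / lam * C1 * (f / (4 * a * kap))) <= gagliardo_kernel s M u x y.
  move=> [[Oy xy] /not_andP[//|/negP]]; rewrite -ltNge /= => Fy.
  have f20 : 0 <= f / 2 by lra.
  have uy : `|lam * u y| < J (f / 2) by rewrite ltNge -F_le_inv// -ltNge.
  have ux : J f <= `|lam * u x| by rewrite -F_le_inv// ltW.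
  have Jf := J_half f0.
  have uxy : N f * f `^ (- th) / 2 / lam <= `|u x - u y|.
    rewrite ler_pdivrMr// [leRHS]mulrC -[X in X * `|_|](gtr0_norm lam0) -normrM mulrBr.
    have := lerB_dist (lam * u x) (lam * u y); rewrite /th; lra.
  pose e := enorm (x - y).
  have e_rho : e <= rho.
    by apply: enorm_le; [exact: ltW|move=> i; rewrite !mxE distrC; exact: xy].
  (* The points differ because [F (lam * u x) >= f] while [F (lam * u y) < f / 2]. *)
  have e0 : 0 < e.
    rewrite lt_neqAle enorm_ge0 andbT; apply/eqP => e0.
    suff xyE : x = y by move: Fx; rewrite /= xyE leNgt => /negP; apply; lra.
    apply/rowP => i; apply/eqP; rewrite -subr_eq0 -normr_eq0 eq_le normr_ge0 andbT.
    by have := coord_le_enorm (x - y) i; rewrite -/e -e0 !mxE.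
  have Nf0 : 0 <= N f by apply: (nfunction_inv_ge0 HM); exact: ltW.
  have fth : 0 < f `^ (- th) by rewrite powR_gt0.
  have argE : C1 / lam * N f <= `|(u x - u y) / e `^ s|.
    rewrite normrM normfV (gtr0_norm (powR_gt0 s e0)).
    have -> : C1 / lam * N f = N f * f `^ (- th) / 2 / lam / rho `^ s.
      rewrite rhos /C1 (powRN (4 * a * kap)).
      by field; rewrite (gt_eqF lam0) (gt_eqF fth) (gt_eqF (powR_gt0 _ ak0)).
    apply: ler_pM => //.
      by rewrite !divr_ge0 ?mulr_ge0// ltW.
      by rewrite invr_ge0 powR_ge0.
    rewrite lef_pV2 ?posrE ?powR_gt0//.
    by apply: ge0_ler_powR; rewrite ?nnegrE// ltW.
  rewrite /gagliardo_kernel -/e.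
  have CN : 0 <= C1 / lam * N f by rewrite mulr_ge0// divr_ge0// ltW.
  apply: ler_pM.
  - exact: flC.
  - exact: divr_ge0 (ltW f0) (ltW ak0).
  (* Here [lam <= C1] enters: the factor [C1 / lam] is at least 1 and comes out of [M], leaving
     [M (N f) = f]. *)
  - apply: (@le_trans _ _ (M (C1 / lam * N f))).
      apply: (le_trans _ (nfunctionZ_ge HM _ _));
          last by rewrite ler_pdivlMr// mul1r.
      by rewrite (nfunction_invK HM (ltW f0)) le_eqVlt mulrAC [C1 / _ * _]mulrAC (mulrC C1) eqxx.
    by apply: (nfunction_le_norm HM); rewrite (ger0_norm CN).
  - have -> : f / (4 * a * kap) = (rho ^+ d)^-1.
      by rewrite rhodE invf_div.
    rewrite lef_pV2 ?posrE ?exprn_gt0//.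
    by rewrite lerXn2r ?nnegrE// ltW.
have K0 : 0 <= f / lam * C1 * (f / (4 * a * kap)).
  exact: mulr_ge0 flC (divr_ge0 (ltW f0) (ltW ak0)).
have mk := measurable_gagliardo_kernelr s HM mO Ox mu_.
apply: (@le_trans _ _ ((f / lam * C1 * (f / (4 * a * kap)))%:E * mu Y)%E);
    last first.
  apply: integral_ge_measure; [exact: mO|exact: mY| | | | |exact: K0].
  - by move=> y [[]].
  - exact/measurable_EFinP.
  - by move=> y _; rewrite lee_fin gagliardo_kernel_ge0.
  - by move=> y Yy; rewrite lee_fin kerY.
apply: (@le_trans _ _ ((f / lam * C1 * (f / (4 * a * kap)))%:E * (2 * kap / f)%:E)%E); last first.
  by apply: lee_wpmul2l; rewrite ?lee_fin.
(* The factor [f] of [mu Y] cancels one of the two in the kernel bound, and [c2] collects the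
   constants. *)
rewrite -EFinM lee_fin /c2 le_eqVlt; apply/orP; left; apply/eqP.
by field; rewrite !gt_eqF.
Qed.

Let J1_gt0 : 0 < J 1.
Proof.
rewrite -(primitive0 (conj_integrand d s M)).
exact: (sobolev_conj_inv_lt HM d0 s0 g_int (lexx 0) ltr01).
Qed.

(** The bounds 1 and [kap * M (J 1) / 2] serve the level 1, [C1] the lower bound of the density, and
    [c2 * kap] the induction step. *)
Let lam : R := Num.min (Num.min 1 C1) (Num.min (c2 * kap) (kap * M (J 1) / 2)).
Let lam_gt0 : 0 < lam.
Proof.
rewrite !lt_min ltr01 C1_gt0 (mulr_gt0 c2_gt0 kap0)/=.
by rewrite divr_gt0// mulr_gt0// (nfunction_gt0 HM).
Qed.
Let lam_le1 : lam <= 1. Proof. by rewrite !ge_min lexx. Qed.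
Let lam_leC1 : lam <= C1. Proof. by rewrite !ge_min lexx !orbT. Qed.
Let lam_le2 : lam <= c2 * kap. Proof. by rewrite !ge_min lexx !orbT. Qed.
Let lam_leM : lam <= kap * M (J 1) / 2. Proof. by rewrite !ge_min lexx !orbT. Qed.

(** On this set [J 1 <= lam * |u|], so [M (u x) >= M (J 1) / lam], and Markov's inequality applies
    to the modular of [M]. *)
Let superlevel1 (u : 'rV[R]_d -> R) : measurable_fun Omega u ->
  (orlicz_modular M Omega u <= 1)%E ->
  (mu (superlevel u lam 1) <= (kap / 2)%:E)%E.
Proof.
move=> mu_ Mu; have MJ := nfunction_gt0 HM J1_gt0.
have : ((M (J 1) / lam)%:E * mu (superlevel u lam 1) <= 1%:E)%E.
  apply: le_trans Mu; apply: integral_ge_measure => //.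
  - exact: measurable_superlevel.
  - by move=> x [].
  - apply/measurable_EFinP.
    exact: (measurableT_comp (continuous_measurable_fun (@nfunction_continuous _ _ HM)) mu_).
  - by move=> x _; rewrite lee_fin (nfunction_ge0 HM).
  - move=> x [Ox]; rewrite /= F_le_inv// normrM (gtr0_norm lam_gt0) => h.
    have lam1 : 1 <= lam^-1 by rewrite invf_ge1.
    rewrite lee_fin mulrC; apply: (le_trans (nfunctionZ_ge HM _ lam1)).
    apply: (nfunction_le_norm HM); rewrite ger0_norm; last first.
      by rewrite mulr_ge0 ?invr_ge0 ?(ltW lam_gt0) ?(ltW J1_gt0).
    by rewrite ler_pdivrMl.
  - exact: divr_ge0 (ltW MJ) (ltW lam_gt0).
rewrite -lee_pdivlMl ?divr_gt0// mule1 => /le_trans; apply.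
by rewrite lee_fin invf_div ler_pdivrMr// mulrAC.
Qed.

(** Dyadic induction: the bound at [f / 2] is the hypothesis of [gagliardo_density_ge] at [f], whose
    conclusion integrates to [(c2 / lam * f) * mu <= 1]; the choice of [lam] closes the loop with
    the same [kap]. *)
Let superlevel_decay (u : 'rV[R]_d -> R) : measurable_fun Omega u ->
  (orlicz_modular M Omega u <= 1)%E -> (gagliardo_modular s M Omega u <= 1)%E ->
  forall f, 1 <= f -> (mu (superlevel u lam f) <= (kap / f)%:E)%E.
Proof.
move=> mu_ Mu Gu.
suff H n f : 1 <= f -> f <= 2 ^+ n -> (mu (superlevel u lam f) <= (kap / f)%:E)%E.
  move=> f f1; apply: (H (Num.trunc f).+1) => //.
  apply: ltW; apply: (lt_le_trans (truncnS_gt f)).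
  by rewrite -natrX ler_nat ltnW// ltn_expl.
elim: n f => [|n IH] f f1 fn.
  have -> : f = 1 by apply/eqP; rewrite eq_le f1 -(expr0 2) fn.
  apply: (le_trans (superlevel1 mu_ Mu)); rewrite lee_fin divr1; have := kap0; lra.
(* Below 2 the level [f / 2] may fall under 1; instead the set is compared with level 1, whose bound
   [kap / 2] is at most [kap / f]. *)
have [f2|f2] := ltP f 2.
  apply: (@le_trans _ _ (kap / 2)%:E); last first.
    by rewrite lee_fin ler_pM2l// lef_pV2 ?posrE//; lra.
  apply: le_trans (superlevel1 mu_ Mu); apply: le_measure.
  - by rewrite inE; exact: measurable_superlevel.
  - by rewrite inE; exact: measurable_superlevel.
  - by move=> x [Ox /= h]; split=> //=; exact: le_trans h.
have f0 : 0 < f by lra.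
have Af : (mu (superlevel u lam (f / 2)) <= (2 * kap / f)%:E)%E.
  have -> : 2 * kap / f = kap / (f / 2) by field; rewrite gt_eqF.
  by apply: IH; [lra|rewrite ler_pdivrMr// -exprSr].
have c2f : 0 < c2 / lam * f by rewrite mulr_gt0// divr_gt0.
have : ((c2 / lam * f)%:E * mu (superlevel u lam f) <= 1%:E)%E.
  apply: le_trans Gu; apply: integral_ge_measure; [exact: mO| | | | | |exact: ltW].
  - exact: measurable_superlevel.
  - by move=> x [].
  - exact: (measurable_gagliardo_density s HM mO mu_).
  - by move=> x _; exact: (gagliardo_density_ge0 s HM).
  - by move=> x Ax; exact: gagliardo_density_ge.
rewrite -lee_pdivlMl// mule1 => /le_trans; apply.
rewrite lee_fin.
have -> : (c2 / lam * f)^-1 = lam / c2 / f.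
  by field; rewrite (gt_eqF f0) (gt_eqF c2_gt0) (gt_eqF lam_gt0).
by rewrite ler_pM2r ?invr_gt0// ler_pdivrMr// mulrC.
Qed.

(** With the decay known at every level, each point [x] can be tested at its own level
    [f = F (lam * u x)]. The resulting pointwise bound integrates to at most [2 * mu Omega + kap],
    and the scaling of [F] by [K^-1] brings the modular below 1. *)
Lemma sobolev_modular_estimate : exists2 C, 0 < C & forall u,
  measurable_fun Omega u -> (orlicz_modular M Omega u <= 1)%E ->
  (gagliardo_modular s M Omega u <= 1)%E ->
  (orlicz_modular F Omega (C^-1 \*o u) <= 1)%E.
Proof.
pose K : R := 2 * fine (mu Omega) + kap + 1.
have O0 : 0 <= fine (mu Omega) by rewrite fine_ge0.
have K1 : 1 <= K by have := kap0; rewrite /K; lra.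
have K0 : 0 < K by lra.
exists (K / lam); first exact: divr_gt0.
move=> u mu_ Mu Gu.
have mFu : measurable_fun Omega (fun x => F (lam * u x)).
  by apply: (measurableT_comp mF); exact: measurable_funM.
have ptw x : Omega x ->
    ((F (lam * u x))%:E <= 2%:E + (lam / c2)%:E * gagliardo_density s M Omega u x)%E.
  move=> Ox; set f := F (lam * u x).
  have G0 : (0 <= (lam / c2)%:E * gagliardo_density s M Omega u x)%E.
    by rewrite mule_ge0 ?(gagliardo_density_ge0 s HM)// lee_fin divr_ge0 ?(ltW lam_gt0) ?(ltW c2_gt0).
  have [f2|f2] := leP f 2.
    by apply: (@le_trans _ _ 2%:E); [rewrite lee_fin|rewrite leeDl].
  apply: (@le_trans _ _ ((lam / c2)%:E * gagliardo_density s M Omega u x)%E);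
      last first.
    by rewrite leeDr// lee_fin.
  rewrite -(lee_pdivrMl _ _ (divr_gt0 lam_gt0 c2_gt0)) invf_div -EFinM.
  apply: gagliardo_density_ge => //; first exact: ltW.
    have -> : 2 * kap / f = kap / (f / 2) by field; rewrite gt_eqF//; lra.
    by apply: superlevel_decay => //; lra.
  by split => //=; exact: lexx.
have Gm := measurable_gagliardo_density s HM mO mu_.
have G0 := gagliardo_density_ge0 s HM Omega u.
have IF : (\int[mu]_(x in Omega) (F (lam * u x))%:E <= (2 * fine (mu Omega) + kap)%:E)%E.
  apply: (@le_trans _ _ (\int[mu]_(x in Omega)
      (cst 2%:E x + (lam / c2)%:E * gagliardo_density s M Omega u x))%E).
    apply: ge0_le_integral => //.
    - by move=> x _; rewrite lee_fin F_ge0.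
    - exact/measurable_EFinP.
    - by apply: emeasurable_funD => //; exact: measurable_funeM.
  have lc : 0 <= lam / c2 := divr_ge0 (ltW lam_gt0) (ltW c2_gt0).
  rewrite ge0_integralD//; first last.
  - exact: measurable_funeM.
  - by move=> x _; rewrite mule_ge0// lee_fin.
  - by move=> x _; rewrite lee_fin.
  have -> : (2 * fine (mu Omega) + kap)%:E = (2%:E * mu Omega + kap%:E)%E.
    by rewrite EFinD EFinM fineK// ge0_fin_numE.
  rewrite integral_cst// ge0_integralZl_EFin//.
  apply: leeD2l.
  apply: (@le_trans _ _ ((lam / c2)%:E * 1%:E)%E); first exact: lee_wpmul2l.
  by rewrite -EFinM mulr1 lee_fin ler_pdivrMr// mulrC.
apply: (@le_trans _ _ (\int[mu]_(x in Omega) (K^-1%:E * (F (lam * u x))%:E))%E).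
  apply: ge0_le_integral => //.
  - by move=> x _; rewrite lee_fin F_ge0.
  - apply/measurable_EFinP; apply: (measurableT_comp mF); exact: measurable_funM.
  - by apply: measurable_funeM; exact/measurable_EFinP.
  - move=> x _; rewrite /= -EFinM lee_fin invf_div mulrAC mulrC.
    apply: (sobolev_conjZ_le HM d0 s0 g_int g_inty).
    by rewrite invr_ge0 invf_le1// K1 (ltW K0).
rewrite ge0_integralZl_EFin//.
- rewrite lee_pdivrMl// mule1; apply: (le_trans IF).
  by rewrite lee_fin /K lerDl.
- by move=> x _; rewrite lee_fin F_ge0.
- exact/measurable_EFinP.
- by rewrite invr_ge0 ltW.
Qed.

End sobolev_modular_estimate.

(** * From modulars to norms *)

Section modular_scaling.
Variables (R : realType) (d : nat) (s : R) (M : R -> R).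
Hypothesis HM : nfunction M.
Variable Omega : set 'rV[R]_d.
Hypothesis mO : measurable Omega.
Local Notation mu := (lebesgue_rV d).
Implicit Types (u : 'rV[R]_d -> R) (k l : R).

Lemma nfunction_measurable_comp u : measurable_fun Omega u ->
  measurable_fun Omega (fun x => (M (u x))%:E).
Proof.
move=> mu_; apply/measurable_EFinP.
exact: (measurableT_comp (continuous_measurable_fun (@nfunction_continuous _ _ HM)) mu_).
Qed.

Let measurable_scale u k : measurable_fun Omega u -> measurable_fun Omega (k \*o u).
Proof. by move=> mu_; exact: measurable_funM. Qed.

Lemma orlicz_modular_le u k l : measurable_fun Omega u -> 0 <= k -> k <= l ->
  (orlicz_modular M Omega (k \*o u) <= orlicz_modular M Omega (l \*o u))%E.
Proof.
move=> mu_ k0 kl; apply: ge0_le_integral => //.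
- by move=> x _; rewrite lee_fin (nfunction_ge0 HM).
- by apply: nfunction_measurable_comp; exact: measurable_scale.
- by apply: nfunction_measurable_comp; exact: measurable_scale.
- move=> x _; rewrite lee_fin; apply: (nfunction_le_norm HM).
  by rewrite /= !normrM ler_wpM2r// (ger0_norm k0) (ger0_norm (le_trans k0 kl)).
Qed.

Lemma orlicz_modularZ u k : measurable_fun Omega u -> 0 <= k <= 1 ->
  (orlicz_modular M Omega (k \*o u) <= k%:E * orlicz_modular M Omega u)%E.
Proof.
move=> mu_ k01; have /andP[k0 k1] := k01;
    rewrite /orlicz_modular -ge0_integralZl_EFin//.
- apply: ge0_le_integral => //.
  + by move=> x _; rewrite lee_fin (nfunction_ge0 HM).
  + by apply: nfunction_measurable_comp; exact: measurable_scale.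
  + by apply: measurable_funeM; exact: nfunction_measurable_comp.
  + by move=> x _; rewrite -EFinM lee_fin (nfunctionZ_le HM).
- by move=> x _; rewrite lee_fin (nfunction_ge0 HM).
- exact: nfunction_measurable_comp.
Qed.

Let gagliardo_kernelE u k x y : gagliardo_kernel s M (k \*o u) x y =
  M (k * ((u x - u y) / enorm (x - y) `^ s)) / enorm (x - y) ^+ d.
Proof. by rewrite /gagliardo_kernel/= -mulrBr mulrA. Qed.

Let gagliardo_modular_mono u v k :
  measurable_fun Omega u -> measurable_fun Omega v -> 0 <= k ->
  (forall x y, gagliardo_kernel s M u x y <= k * gagliardo_kernel s M v x y) ->
  (gagliardo_modular s M Omega u <= k%:E * gagliardo_modular s M Omega v)%E.
Proof.
move=> mu_ mv_ k0 uv.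
have mG := measurable_gagliardo_density s HM mO.
have G0 := gagliardo_density_ge0 s HM Omega.
rewrite -[X in (_ <= _ * X)%E]/(\int[mu]_(x in Omega) gagliardo_density s M Omega v x)%E.
rewrite -ge0_integralZl_EFin//; last exact: mG.
apply: ge0_le_integral => //.
- by move=> x _; exact: G0.
- exact: mG.
- by apply: measurable_funeM; exact: mG.
move=> x Ox; rewrite /gagliardo_density -ge0_integralZl_EFin//.
- apply: ge0_le_integral => //.
  + by move=> y _; rewrite lee_fin; exact: (gagliardo_kernel_ge0 s HM).
  + by apply/measurable_EFinP; exact: (measurable_gagliardo_kernelr s HM mO Ox mu_).
  + by apply: measurable_funeM; apply/measurable_EFinP;
      exact: (measurable_gagliardo_kernelr s HM mO Ox mv_).
  + by move=> y _; rewrite -EFinM lee_fin uv.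
- by move=> y _; rewrite lee_fin; exact: (gagliardo_kernel_ge0 s HM).
- by apply/measurable_EFinP; exact: (measurable_gagliardo_kernelr s HM mO Ox mv_).
Qed.

Lemma gagliardo_modular_le u k l : measurable_fun Omega u -> 0 <= k -> k <= l ->
  (gagliardo_modular s M Omega (k \*o u) <= gagliardo_modular s M Omega (l \*o u))%E.
Proof.
move=> mu_ k0 kl; rewrite -[leRHS]mul1e.
apply: gagliardo_modular_mono; try exact: measurable_scale; first exact: ler01.
move=> x y; rewrite mul1r !gagliardo_kernelE ler_wpM2r//.
  by rewrite invr_ge0 exprn_ge0 ?enorm_ge0.
apply: (nfunction_le_norm HM).
by rewrite (normrM k) (normrM l) ler_wpM2r// (ger0_norm k0) (ger0_norm (le_trans k0 kl)).
Qed.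

Lemma gagliardo_modularZ u k : measurable_fun Omega u -> 0 <= k <= 1 ->
  (gagliardo_modular s M Omega (k \*o u) <= k%:E * gagliardo_modular s M Omega u)%E.
Proof.
move=> mu_ k01; have /andP[k0 k1] := k01.
apply: gagliardo_modular_mono => //; first exact: measurable_scale.
move=> x y; rewrite gagliardo_kernelE /gagliardo_kernel [leRHS]mulrA ler_wpM2r//.
  by rewrite invr_ge0 exprn_ge0 ?enorm_ge0.
exact: (nfunctionZ_le HM).
Qed.

Lemma orlicz_modular_ge0 u : (0 <= orlicz_modular M Omega u)%E.
Proof. by apply: integral_ge0 => x _; rewrite lee_fin (nfunction_ge0 HM). Qed.

Lemma gagliardo_modular_ge0 u : (0 <= gagliardo_modular s M Omega u)%E.
Proof. by apply: integral_ge0 => x _; exact: (gagliardo_density_ge0 s HM). Qed.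

Lemma scale_scale u k l : k \*o (l \*o u) = (k * l) \*o u.
Proof. by apply/funext => x /=; rewrite mulrA. Qed.

Let small_factor (a : \bar R) : (0 <= a)%E -> (a < +oo)%E ->
  exists2 k, 0 < k <= 1 & (k%:E * a <= 1)%E.
Proof.
case: a => [r| |]//; rewrite lee_fin => r0 _.
exists (r + 1)^-1.
  by rewrite invr_gt0 invf_le1 ?ltr_wpDl//= lerDr.
by rewrite -EFinM lee_fin mulrC ler_pdivrMr ?mul1r ?lerDl// ltr_wpDl.
Qed.

(** Membership only gives finite modulars, the first one after a scaling by [l]; convexity at the
    origin makes them at most 1 after a further contraction. *)
Lemma frac_sobolev_normalize u : frac_sobolev_space s M Omega u ->
  exists2 N, 0 < N & (orlicz_modular M Omega (N^-1 \*o u) <= 1)%E /\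
    (gagliardo_modular s M Omega (N^-1 \*o u) <= 1)%E.
Proof.
move=> [[mu_ [l l0 lu]] Gu].
have [k1 /andP[k10 k11] k1u] := small_factor (orlicz_modular_ge0 _) lu.
have [k2 /andP[k20 k21] k2u] := small_factor (gagliardo_modular_ge0 _) Gu.
(* A sum dominates both required divisors, so one [N] serves both modulars. *)
pose N := (k1 * l)^-1 + k2^-1.
have k1l : 0 < (k1 * l)^-1 by rewrite invr_gt0 mulr_gt0.
have k2i : 0 < k2^-1 by rewrite invr_gt0.
have N0 : 0 < N by rewrite /N addr_gt0.
exists N => //; split.
- apply: le_trans k1u; apply: le_trans (orlicz_modularZ _ _).
  + rewrite scale_scale; apply: orlicz_modular_le => //;
      first by rewrite invr_ge0 ltW.
    by rewrite -[leRHS]invrK lef_pV2 ?posrE// lerDl ltW.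
  + exact: measurable_scale.
  + by rewrite ltW.
- have k20' : 0 <= k2 <= 1 by rewrite ltW.
  apply: le_trans k2u; apply: le_trans (gagliardo_modularZ mu_ k20').
  apply: gagliardo_modular_le => //; first by rewrite invr_ge0 ltW.
  by rewrite -[leRHS]invrK lef_pV2 ?posrE// lerDr ltW.
Qed.

Lemma luxemburg_norm_ge0 (A : R -> R) u : (0 <= luxemburg_norm A Omega u)%E.
Proof. by apply: le_ereal_inf_tmp => _ [l [l0 _] <-]; rewrite lee_fin ltW. Qed.

Lemma gagliardo_seminorm_ge0 u : (0 <= gagliardo_seminorm s M Omega u)%E.
Proof. by apply: le_ereal_inf_tmp => _ [l [l0 _] <-]; rewrite lee_fin ltW. Qed.

(** Strictness yields an admissible [l < N] below each infimum, so attainment of the infima is not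
    at issue; monotonicity in the scale then gives [N]. *)
Lemma frac_sobolev_norm_lt u N : measurable_fun Omega u -> 0 < N ->
  (frac_sobolev_norm s M Omega u < N%:E)%E ->
  (orlicz_modular M Omega (N^-1 \*o u) <= 1)%E /\
  (gagliardo_modular s M Omega (N^-1 \*o u) <= 1)%E.
Proof.
move=> mu_ N0 uN.
have inv_le l : 0 < l -> l < N -> 0 <= N^-1 /\ N^-1 <= l^-1.
  by move=> l0 lN; rewrite invr_ge0 lef_pV2 ?posrE// !ltW.
split.
- have : (luxemburg_norm M Omega u < N%:E)%E.
    by apply: le_lt_trans uN; rewrite leeDl// gagliardo_seminorm_ge0.
  move=> /ereal_inf_lt[_ [l [l0 lu] <-]]; rewrite lte_fin => /(inv_le _ l0)[h1 h2].
  by apply: le_trans lu; exact: orlicz_modular_le.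
- have : (gagliardo_seminorm s M Omega u < N%:E)%E.
    by apply: le_lt_trans uN; rewrite leeDr// luxemburg_norm_ge0.
  move=> /ereal_inf_lt[_ [l [l0 lu] <-]]; rewrite lte_fin => /(inv_le _ l0)[h1 h2].
  by apply: le_trans lu; exact: gagliardo_modular_le.
Qed.

Lemma continuous_embedding_modular (A : R -> R) (C : R) : 0 < C ->
  (forall u, measurable_fun Omega u -> (orlicz_modular M Omega u <= 1)%E ->
    (gagliardo_modular s M Omega u <= 1)%E ->
    (orlicz_modular A Omega (C^-1 \*o u) <= 1)%E) ->
  continuous_embedding (frac_sobolev_space s M Omega) (frac_sobolev_norm s M Omega)
    (orlicz_space A Omega) (luxemburg_norm A Omega).
Proof.
move=> C0 HC; split.
  move=> u Xu; have [N N0 [Mu Gu]] := frac_sobolev_normalize Xu.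
  have mu_ : measurable_fun Omega u by case: Xu => -[].
  split => //; exists (C^-1 * N^-1); first by rewrite mulr_gt0 ?invr_gt0.
  rewrite -scale_scale; apply: (@le_lt_trans _ _ 1%E); last exact: ltry.
  by apply: HC => //; exact: measurable_scale.
exists C => // u Xu; have mu_ : measurable_fun Omega u by case: Xu => -[].
have nu0 : (0 <= frac_sobolev_norm s M Omega u)%E.
  exact: adde_ge0 (luxemburg_norm_ge0 _ _) (gagliardo_seminorm_ge0 _).
case E : (frac_sobolev_norm s M Omega u) => [x| |].
(* The norm [x] is replaced by [x + e], which exceeds it strictly and is positive even when
   [x = 0]. *)
- rewrite -lee_pdivrMl//; apply/lee_addgt0Pr => e e0; rewrite -EFinD.
  have x0 : 0 <= x by rewrite E lee_fin in nu0.
  have xe0 : 0 < x + e by lra.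
  rewrite lee_pdivrMl// -EFinM; apply: ereal_inf_lbound.
  exists (C * (x + e)) => //; split; first by rewrite /= mulr_gt0.
  have [] := @frac_sobolev_norm_lt u (x + e) mu_ xe0.
    by rewrite E lte_fin; lra.
  move=> Mu Gu; rewrite invfM -scale_scale.
  by apply: HC => //; exact: measurable_scale.
- by rewrite gt0_muley ?lte_fin// leey.
- by rewrite E in nu0.
Qed.

End modular_scaling.

(** * Compactness *)

Section diagonal.
Variable R : realType.

(** The rows [a n] lie in a product of segments, compact by Tychonoff; [alpha] is a cluster point,
    and neighbourhoods in the product topology control finitely many coordinates. *)
Lemma cluster_sequence (a : nat -> nat -> R) (K : nat -> R) :
  (forall n i, `|a n i| <= K i) ->
  exists alpha : nat -> R, forall k e, 0 < e -> forall N, exists n,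
    (N <= n)%N /\ forall i, (i < k)%N -> `|a n i - alpha i| <= e.
Proof.
move=> aK.
pose T (i : nat) : topologicalType := R.
have := @tychonoff nat T (fun i => `[- K i, K i]%classic).
move=> /(_ (fun i => @segment_compact R (- K i) (K i))).
move=> /(_ (a @ \oo) _)[].
  by exists 0%N => // n _ /= i; rewrite in_itv/= -ler_norml.
move=> alpha [_ cl]; exists alpha => k e e0 N.
have FN : (a @ \oo) [set f | exists n, (N <= n)%N /\ f = a n].
  by exists N => // n /= Nn; exists n.
have nU : nbhs alpha [set f : forall i, T i | forall i, (i < k)%N ->
    `|f i - alpha i| <= e].
  elim: k => [|k IH]; first by apply: filterS filterT => f _ i.
  have pk : nbhs alpha (proj k @^-1` [set y : R | `|y - alpha k| <= e]).
    apply: (@proj_continuous _ T k alpha).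
    apply/nbhs_ballP; exists e => // y; rewrite -ball_normE/= distrC.
    exact: ltW.
  apply: filterS2 IH pk => f fk fkk i; rewrite ltnS leq_eqVlt => /predU1P[->|].
    exact: fkk.
  exact: fk.
have [f [[n [Nn ->]] fn]] := cl _ _ FN nU.
by exists n.
Qed.

Lemma increasing_choice (P : nat -> nat -> Prop) :
  (forall k N, exists n, (N <= n)%N /\ P k n) ->
  exists phi : nat -> nat, {homo phi : m n / (m < n)%N} /\ forall k, P k (phi k).
Proof.
move=> HP.
have [f fP] : {f : nat * nat -> nat &
    forall kN, (kN.2 <= f kN)%N /\ P kN.1 (f kN)}.
  by apply: (@choice _ _ (fun kN n => (kN.2 <= n)%N /\ P kN.1 n)) => -[k N];
      exact: HP.
pose phi := fix phi (k : nat) : nat :=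
  if k is k'.+1 then f (k, (phi k').+1) else f (0%N, 0%N).
exists phi; split.
  apply: homo_ltn; first exact: ltn_trans.
  by move=> k; have [] := fP (k.+1, (phi k).+1).
by case=> [|k]; [have [] := fP (0%N, 0%N)|have [] := fP (k.+1, (phi k).+1)].
Qed.

Lemma increasing_ge (phi : nat -> nat) : {homo phi : m n / (m < n)%N} ->
  forall n, (n <= phi n)%N.
Proof.
by move=> ph; elim=> // n IH; apply: (leq_ltn_trans IH); exact: ph.
Qed.

(** The row [phi k] is taken within [1 / (k + 1)] of the cluster point on the first [k]
    coordinates. *)
Lemma diagonal_subsequence (a : nat -> nat -> R) (K : nat -> R) :
  (forall n i, `|a n i| <= K i) ->
  exists2 phi : nat -> nat, {homo phi : m n / (m < n)%N} &
    forall k e, 0 < e -> exists N, forall n m, (N <= n)%N -> (N <= m)%N ->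
      forall i, (i < k)%N -> `|a (phi n) i - a (phi m) i| <= e.
Proof.
move=> /cluster_sequence[alpha cl].
have k0 k : 0 < (k.+1%:R : R)^-1 by rewrite invr_gt0.
have [phi [phi_lt phiP]] := increasing_choice (fun k N => cl k _ (k0 k) N).
exists phi => // k e e0; exists (maxn k (Num.trunc (2 / e))) => n m.
rewrite !geq_max => /andP[kn en] /andP[km em] i ik.
have small p : (k <= p)%N -> (Num.trunc (2 / e) <= p)%N ->
    `|a (phi p) i - alpha i| <= e / 2.
  move=> kp ep; apply: (le_trans (phiP p i (leq_trans ik kp))).
  rewrite invf_ple ?posrE ?divr_gt0// invf_div.
  apply: (le_trans (ltW (truncnS_gt _))).
  by rewrite ler_nat ltnS.
rewrite -(subrKA (alpha i)).
apply: (le_trans (ler_normD _ _)).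
have := small n kn en; have := small m km em; rewrite distrC => h1 h2; lra.
Qed.

End diagonal.

(** * Approximation by a constant on a cell *)

Section local_approximation.
Variables (R : realType) (d : nat) (s : R) (M : R -> R) (Omega : set 'rV[R]_d).
Hypothesis s0 : 0 < s.
Hypothesis HM : nfunction M.
Hypothesis mO : measurable Omega.
Local Notation mu := (lebesgue_rV d).
Implicit Types u w : 'rV[R]_d -> R.

(** For [|t| > 1], scaling from the point 1 gives [M t >= |t| * M 1]. *)
Lemma nfunction_linear_bound (t : R) : `|t| <= 1 + M t / M 1.
Proof.
have M1 : 0 < M 1 by exact: (nfunction_gt0 HM).
have [t1|t1] := leP `|t| 1.
  by apply: (le_trans t1); rewrite lerDl divr_ge0 ?(nfunction_ge0 HM)// ltW.
have h : `|t| <= M t / M 1.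
  rewrite ler_pdivlMr// -(nfunction_norm HM t) -{2}(mulr1 `|t|).
  by apply: (nfunctionZ_ge HM); exact: ltW.
by apply: (le_trans h); rewrite lerDr.
Qed.

(** The two terms are added so that one well-chosen point controls both the oscillation around it
    and the value of [u] there. *)
Definition energy_density u (x : 'rV[R]_d) : \bar R :=
  (gagliardo_density s M Omega u x + (M (u x))%:E)%E.
Local Notation G := energy_density.

Lemma energy_density_ge0 u x : (0 <= G u x)%E.
Proof.
by rewrite adde_ge0 ?(gagliardo_density_ge0 s HM)// lee_fin (nfunction_ge0 HM).
Qed.

Lemma measurable_energy_density u : measurable_fun Omega u ->
  measurable_fun Omega (G u).
Proof.
move=> mu_; apply: emeasurable_funD.
  exact: (measurable_gagliardo_density s HM mO).
exact: nfunction_measurable_comp.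
Qed.

Lemma integral_energy_density u : measurable_fun Omega u ->
  (orlicz_modular M Omega u <= 1)%E -> (gagliardo_modular s M Omega u <= 1)%E ->
  (\int[mu]_(x in Omega) G u x <= 2%:E)%E.
Proof.
move=> mu_ Mu Gu; rewrite ge0_integralD//.
- by rewrite -(_ : 1 + 1 = 2%:E)%E; [exact: leeD|rewrite -EFinD].
- by move=> x _; exact: (gagliardo_density_ge0 s HM).
- exact: (measurable_gagliardo_density s HM mO).
- by move=> x _; rewrite lee_fin (nfunction_ge0 HM).
- exact: nfunction_measurable_comp.
Qed.

Section on_a_cell.
Variables (Q : set 'rV[R]_d) (q rho : R).
Hypothesis mQ : measurable Q.
Hypothesis QO : Q `<=` Omega.
Hypothesis q0 : 0 < q.
Hypothesis muQ : mu Q = q%:E.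
Hypothesis rho0 : 0 < rho.
Hypothesis diamQ : forall x y, Q x -> Q y -> enorm (x - y) <= rho.

Let b : R := rho ^+ d / q / M 1.

Let M1 : 0 < M 1. Proof. exact: (nfunction_gt0 HM). Qed.

Let b0 : 0 <= b.
Proof. by rewrite !divr_ge0 ?exprn_ge0// ltW. Qed.

(** With [t] the fractional difference quotient, [|u y - u x|] is [enorm (x - y) ^ s * |t|], the
    linear bound controls [|t|], and [M t] is the kernel times [enorm (x - y) ^+ d]. *)
Let kernel_bound u x y : Q x -> Q y ->
  `|u y - u x| <= rho `^ s * (1 + rho ^+ d / M 1 * gagliardo_kernel s M u x y).
Proof.
move=> Qx Qy; have rd0 : 0 <= rho ^+ d / M 1 by rewrite divr_ge0 ?exprn_ge0// ltW.
have [e0|e0] := eqVneq (enorm (x - y)) 0.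
  have -> : x = y.
    apply/rowP => i; apply/eqP; rewrite -subr_eq0 -normr_eq0 eq_le normr_ge0 andbT.
    by have := coord_le_enorm (x - y) i; rewrite e0 !mxE.
  rewrite subrr normr0 mulr_ge0 ?powR_ge0// addr_ge0// mulr_ge0//.
  exact: gagliardo_kernel_ge0.
have {}e0 : 0 < enorm (x - y) by rewrite lt_neqAle eq_sym e0 enorm_ge0.
set t := (u x - u y) / enorm (x - y) `^ s.
have es : 0 < enorm (x - y) `^ s by rewrite powR_gt0.
have -> : `|u y - u x| = enorm (x - y) `^ s * `|t|.
  by rewrite distrC /t normrM normfV (gtr0_norm es) mulrC divfK// gt_eqF.
apply: ler_pM => //; first exact: ltW.
  by apply: ge0_ler_powR; rewrite ?nnegrE ?enorm_ge0 ?(ltW rho0) ?(ltW s0)//;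
      exact: diamQ.
apply: (le_trans (nfunction_linear_bound t));
    rewrite lerD2l mulrAC ler_pM2r ?invr_gt0//.
have -> : M t = enorm (x - y) ^+ d * gagliardo_kernel s M u x y.
  by rewrite /gagliardo_kernel -/t mulrC divfK// gt_eqF// exprn_gt0.
rewrite ler_wpM2r ?(gagliardo_kernel_ge0 s HM)//.
by rewrite lerXn2r ?nnegrE ?enorm_ge0 ?(ltW rho0)//; exact: diamQ.
Qed.

(* The constant is a value u x at a point x where the energy density does not
   exceed its mean over Q by more than 1. *)
Lemma constant_approximation u : measurable_fun Omega u ->
  (orlicz_modular M Omega u <= 1)%E -> (gagliardo_modular s M Omega u <= 1)%E ->
  exists2 c, `|c| <= 1 + (2 + q) / q / M 1 &
    (\int[mu]_(y in Q) `|u y - c|%:E <=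
     \int[mu]_(y in Q) ((rho `^ s * (1 + b))%:E + (rho `^ s * b)%:E * G u y))%E.
Proof.
move=> mu_ Mu Gu.
have mG := measurable_energy_density mu_.
have mGQ : measurable_fun Q (G u) by exact: measurable_funS mG.
have I2 : (\int[mu]_(x in Q) G u x <= 2%:E)%E.
  apply: le_trans (integral_energy_density mu_ Mu Gu).
  by apply: ge0_subset_integral => // x _; exact: energy_density_ge0.
have I0 : (0 <= \int[mu]_(x in Q) G u x)%E.
  by apply: integral_ge0 => x _; exact: energy_density_ge0.
have [I IE] : exists I : R, (\int[mu]_(x in Q) G u x)%E = I%:E.
  exists (fine (\int[mu]_(x in Q) G u x)%E); rewrite fineK// ge0_fin_numE//.
  by apply: (le_lt_trans I2); exact: ltry.
rewrite IE !lee_fin in I0 I2.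
have Iq0 : 0 <= (I + q) / q by rewrite divr_ge0 ?addr_ge0// ltW.
(* If the density exceeded [I / q + 1] on all of [Q], its integral would be at least [I + q > I]. *)
have [x Qx Gx] : exists2 x, Q x & (G u x <= ((I + q) / q)%:E)%E.
  apply: contrapT => h.
  have : (((I + q) / q)%:E * mu Q <= \int[mu]_(x in Q) G u x)%E.
    apply: integral_ge_measure => //; first by move=> x _;
        exact: energy_density_ge0.
    move=> x Qx; have [//|Gx] := leP ((I + q) / q)%:E (G u x).
    by exfalso; apply: h; exists x => //; exact: ltW.
  by rewrite IE muQ -EFinM lee_fin (divfK (lt0r_neq0 q0)) => hI; move: q0; lra.
have Px : (gagliardo_density s M Omega u x <= ((I + q) / q)%:E)%E.
  by apply: le_trans Gx; rewrite leeDl// lee_fin (nfunction_ge0 HM).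
have Mx : M (u x) <= (I + q) / q.
  by rewrite -lee_fin; apply: le_trans Gx;
      rewrite leeDr// (gagliardo_density_ge0 s HM).
have rs0 : 0 <= rho `^ s by exact: powR_ge0.
have rd0 : 0 <= rho ^+ d / M 1 by rewrite divr_ge0 ?exprn_ge0// ltW.
exists (u x).
  apply: (le_trans (nfunction_linear_bound _)).
  rewrite lerD2l ler_pM2r ?invr_gt0//; apply: (le_trans Mx).
  by rewrite ler_pM2r ?invr_gt0//; lra.
have mk := measurable_gagliardo_kernelr s HM mO (QO Qx) mu_.
have mkQ : measurable_fun Q (fun y => (gagliardo_kernel s M u x y)%:E).
  by apply/measurable_EFinP; exact: measurable_funS mk.
have muQ_ : measurable_fun Q (fun y => `|u y - u x|%:E).
  apply/measurable_EFinP; apply: (measurableT_comp (@normr_measurable _ setT)).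
  by apply: measurable_funB => //; exact: measurable_funS mu_.
apply: (@le_trans _ _ (\int[mu]_(y in Q)
    ((rho `^ s)%:E + (rho `^ s * (rho ^+ d / M 1))%:E * (gagliardo_kernel s M u x y)%:E))%E).
  apply: ge0_le_integral => //.
  - by apply: emeasurable_funD => //; exact: measurable_funeM.
  - move=> y Qy; rewrite -EFinM -EFinD lee_fin.
    by have := kernel_bound u Qx Qy; rewrite mulrDr mulr1 mulrA.
have rr0 : 0 <= rho `^ s * (rho ^+ d / M 1) by exact: mulr_ge0.
rewrite ge0_integralD//; first last.
- exact: measurable_funeM.
- by move=> y _; rewrite mule_ge0// lee_fin ?(gagliardo_kernel_ge0 s HM).
rewrite ge0_integralD//; first last.
- exact: measurable_funeM.
- by move=> y _; rewrite mule_ge0 ?energy_density_ge0// lee_fin mulr_ge0.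
- by move=> y _; rewrite lee_fin mulr_ge0// addr_ge0.
have rb0 : 0 <= rho `^ s * b by exact: mulr_ge0.
rewrite (ge0_integralZl_EFin _ _ _ _ rr0)//; last first.
  by move=> y _; rewrite lee_fin (gagliardo_kernel_ge0 s HM).
rewrite (ge0_integralZl_EFin _ _ _ _ rb0)//; last first.
  by move=> y _; exact: energy_density_ge0.
have icst k : (\int[mu]_(y in Q) cst k%:E y = k%:E * q%:E)%E.
  by transitivity (k%:E * mu Q)%E; [exact: integral_cst|rewrite muQ].
rewrite !icst IE.
(* The inner integral over [Q] is at most the full one at [x], hence at most [(I + q) / q]. Dividing
   by [q] here turns [rho ^+ d / M 1] into [b], and the bound becomes an integral over [Q] that can
   be summed over cells. *)
apply: (@le_trans _ _ ((rho `^ s)%:E * q%:E +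
    (rho `^ s * (rho ^+ d / M 1))%:E * ((I + q) / q)%:E)%E).
  apply: leeD2l; apply: lee_wpmul2l; first by rewrite lee_fin.
  apply: le_trans Px; apply: ge0_subset_integral => //.
    exact/measurable_EFinP.
  by move=> y _; rewrite lee_fin (gagliardo_kernel_ge0 s HM).
rewrite -!EFinM -!EFinD lee_fin le_eqVlt; apply/orP; left; apply/eqP.
by rewrite /b; field; rewrite !gt_eqF.
Qed.

End on_a_cell.
End local_approximation.

Lemma measure_vanishing dd (T : measurableType dd) (R : realType)
    (mu : {measure set T -> \bar R}) (A : (set T)^nat) :
  (mu (A 0%N) < +oo)%E -> (forall n, measurable (A n)) ->
  {homo A : n m / (n <= m)%N >-> m `<=` n} -> \bigcap_n A n = set0 ->
  forall e : R, 0 < e -> exists N, forall n, (N <= n)%N -> (mu (A n) <= e%:E)%E.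
Proof.
move=> A0 mA ndA capA e e0.
have := @nonincreasing_cvg_mu _ _ _ mu A A0 mA.
rewrite capA => /(_ measurable0) h.
have {h} : (mu \o A) n @[n --> \oo] --> mu set0.
  by apply: h => n m nm; apply/subsetPset; exact: ndA.
rewrite measure0.
move=> /fine_cvgP[finA /cvgrPdist_le/(_ _ e0) cvA].
have [N1 _ HN1] := finA; have [N2 _ HN2] := cvA.
exists (maxn N1 N2) => n; rewrite geq_max => /andP[n1 n2].
have fA := HN1 n n1; have := HN2 n n2; rewrite /= sub0r normrN.
rewrite ger0_norm ?fine_ge0// -lee_fin fineK//.
Qed.

(** * Grid cells inside the domain *)

Section inner_cells.
Variables (R : realType) (d : nat) (Omega : set 'rV[R]_d).
Hypothesis oO : open Omega.
Local Notation mu := (lebesgue_rV d).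
Hypothesis Ofin : (mu Omega < +oo)%E.

Let h (k : nat) : R := k.+1%:R^-1.
Let h0 k : 0 < h k. Proof. by rewrite invr_gt0. Qed.
Let mO : measurable Omega. Proof. exact: open_measurable_rV. Qed.

(** Cells of mesh [1 / (k + 1)], enumerated by the codes [j] of integer vectors; numbers that are
    not codes, and cells leaving [Omega], give the empty set. *)
Definition inner_cell (k j : nat) : set 'rV[R]_d :=
  if pickle_inv j is Some z then
    if `[< cell (h k) z `<=` Omega >] then cell (h k) z else set0
  else set0.

Lemma measurable_inner_cell k j : measurable (inner_cell k j).
Proof.
rewrite /inner_cell; case: pickle_inv => // z; case: ifP => // _.
exact: measurable_cube.
Qed.

Lemma inner_cell_sub k j : inner_cell k j `<=` Omega.
Proof.
rewrite /inner_cell; case: pickle_inv => // z.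
by case: asboolP => // _ x [].
Qed.

Lemma inner_cell_cube k j : inner_cell k j = set0 \/
  exists a, inner_cell k j = cube a (h k).
Proof.
rewrite /inner_cell; case: pickle_inv => [z|]; last by left.
by case: asboolP => // _; [right; eexists|left].
Qed.

Lemma trivIset_inner_cell k : trivIset setT (inner_cell k).
Proof.
move=> i j _ _ [x]; rewrite /inner_cell.
have hi := @pickle_invK 'rV[int]_d i; have hj := @pickle_invK 'rV[int]_d j.
move: hi hj; case: pickle_inv => [z|] /= hi; last by move=> _ [].
case: pickle_inv => [z'|] /= hj; last by move=> [].
case: asboolP => _; last by move=> [].
case: asboolP => _; last by move=> [].
by move=> [xz xz']; rewrite -hi -hj (cell_eq (h0 k) xz xz').
Qed.

Let U k := \bigcup_j inner_cell k j.

Let mU k : measurable (U k).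
Proof. by apply: bigcupT_measurable => j; exact: measurable_inner_cell. Qed.

Let U_near x : Omega x -> exists K, forall k, (K <= k)%N -> U k x.
Proof.
move=> Ox; have [e e0 eO] := nbhs_box (open_nbhs_nbhs (conj oO Ox)).
exists (Num.trunc e^-1) => k ek; have [z zx] := cell_cover x (h0 k).
exists (pickle z) => //; rewrite /inner_cell pickleK_inv.
case: asboolP => // -[]; apply: subset_trans eO.
apply: subset_trans (cube_box zx) _ => y yx i; apply: (le_trans (yx i)).
rewrite invf_ple ?posrE//; apply: (le_trans (ltW (truncnS_gt _))).
by rewrite ler_nat ltnS.
Qed.

Definition inner_cells (k J : nat) : set 'rV[R]_d :=
  \big[setU/set0]_(j <- iota 0 J) inner_cell k j.

Lemma measurable_inner_cells k J : measurable (inner_cells k J).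
Proof. by apply: bigsetU_measurable => j _; exact: measurable_inner_cell. Qed.

Lemma inner_cells_sub k J : inner_cells k J `<=` Omega.
Proof.
rewrite /inner_cells; elim: (iota 0 J) => [|j l IH]; first by rewrite big_nil.
by rewrite big_cons subUset; split=> //; exact: inner_cell_sub.
Qed.

Let inner_cells_in k j J : (j < J)%N -> inner_cell k j `<=` inner_cells k J.
Proof.
by move=> jJ; rewrite /inner_cells (big_rem j)//= mem_iota.
Qed.

(** Half of [e] pays for a mesh [k] whose inner cells nearly fill [Omega], the other half for
    keeping finitely many of them. The bound [K] lets the mesh be as fine as desired. *)
Lemma inner_cells_exhaust (e : R) K : 0 < e ->
  exists k J, (K <= k)%N /\ (mu (Omega `\` inner_cells k J) <= e%:E)%E.
Proof.
move=> e0; have e20 : 0 < e / 2 by rewrite divr_gt0.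
(* The sets [U k] need not increase with [k], so tail unions of the complements are used; these
   decrease to the empty set because each point of the open set lies in [U k] for all large [k]. *)
pose W n := \bigcup_(k in [set k | (n <= k)%N]) (Omega `\` U k).
have mW n : measurable (W n).
  by apply: bigcup_measurable => k _; exact: measurableD.
have WO n : W n `<=` Omega by move=> x [k _ []].
have lefin A : measurable A -> A `<=` Omega -> (mu A < +oo)%E.
  by move=> mA AO; apply: le_lt_trans Ofin; apply: le_measure; rewrite ?inE.
have ndW : {homo W : n m / (n <= m)%N >-> m `<=` n}.
  by move=> n m nm x [k km Hk]; exists k => //; exact: leq_trans nm km.
have capW : \bigcap_n W n = set0.
  apply/seteqP; split => // x Wx; have Ox := WO 0%N x (Wx 0%N I).
  have [k0 Hk0] := U_near Ox.
  by have [k k0k [_ []]] := Wx k0 I; exact: Hk0.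
have [k1 Hk1] := measure_vanishing (lefin _ (mW 0%N) (WO 0%N)) mW ndW capW e20.
pose k := maxn K k1.
have Uk : (mu (Omega `\` U k) <= (e / 2)%:E)%E.
  apply: le_trans (Hk1 k (leq_maxr _ _)); apply: le_measure.
  - by rewrite inE; exact: measurableD.
  - by rewrite inE.
  - by move=> x Ux; exists k => /=.
have mE J := measurable_inner_cells k J.
have EU J : inner_cells k J `<=` U k.
  rewrite /inner_cells; elim: (iota 0 J) => [|j l IH]; first by rewrite big_nil.
  by rewrite big_cons subUset; split=> //; exact: bigcup_sup.
pose D J := U k `\` inner_cells k J.
have mD J : measurable (D J) by exact: measurableD.
have DO : D 0%N `<=` Omega by move=> x [[j _ /inner_cell_sub]].
have ndD : {homo D : n m / (n <= m)%N >-> m `<=` n}.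
  move=> n m nm x [Ux nE]; split=> // En; apply: nE.
  move: En; rewrite /inner_cells -(subnKC nm) iotaD big_cat/=; exact: subsetUl.
have capD : \bigcap_n D n = set0.
  apply/seteqP; split => // x Hx; have [[j _ jx] _] := Hx 0%N I.
  by have [_ []] := Hx j.+1 I; exact: (inner_cells_in (ltnSn j)) jx.
have [J HJ] := measure_vanishing (lefin _ (mD 0%N) DO) mD ndD capD e20.
exists k, J; split; first exact: leq_maxl.
have -> : Omega `\` inner_cells k J = (Omega `\` U k) `|` (U k `\` inner_cells k J).
  apply/seteqP; split => x.
    move=> [Ox nE]; have [Ux|nUx] := pselect (U k x); first by right.
    by left.
  move=> [[Ox nU]|[[j _ Ux] nE]]; split=> //; first by move=> /EU.
  exact: inner_cell_sub Ux.
have mA : measurable (Omega `\` U k) by exact: measurableD.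
have mB : measurable (U k `\` inner_cells k J) by exact: measurableD.
apply: (le_trans (measureU2 mu mA mB)).
by rewrite (splitr e) EFinD; apply: leeD => //; exact: HJ.
Qed.

End inner_cells.

(** * A subsequence Cauchy in mean up to small sets *)

Section cauchy_subsequence.
Variables (R : realType) (d : nat) (s : R) (M : R -> R) (Omega : set 'rV[R]_d).
Hypothesis d0 : (0 < d)%N.
Hypothesis s0 : 0 < s.
Hypothesis HM : nfunction M.
Hypothesis oO : open Omega.
Local Notation mu := (lebesgue_rV d).
Hypothesis Ofin : (mu Omega < +oo)%E.
Variable w : nat -> 'rV[R]_d -> R.
Hypothesis mw : forall n, measurable_fun Omega (w n).
Hypothesis Mw : forall n, (orlicz_modular M Omega (w n) <= 1)%E.
Hypothesis Gw : forall n, (gagliardo_modular s M Omega (w n) <= 1)%E.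

Let mO : measurable Omega. Proof. exact: open_measurable_rV. Qed.
Let M1 : 0 < M 1. Proof. exact: (nfunction_gt0 HM). Qed.
Let D : R := d%:R.
Let D0 : 0 < D. Proof. by rewrite ltr0n. Qed.
Let h (k : nat) : R := k.+1%:R^-1.
Let h0 k : 0 < h k. Proof. by rewrite invr_gt0. Qed.
Let rs k : R := (D * h k) `^ s.
Let rs0 k : 0 <= rs k. Proof. exact: powR_ge0. Qed.
(** For a cube of side [h k] and [rho = D * h k], the ratio [rho ^+ d / h k ^+ d] equals [D ^+ d]:
    this constant is the same for all meshes, and only [rs k] depends on [k]. *)
Let b : R := D ^+ d / M 1.
Let b0 : 0 <= b. Proof. by rewrite divr_ge0 ?exprn_ge0// ltW. Qed.
Local Notation G n := (energy_density s M Omega (w n)).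
Let H k n x : \bar R := ((rs k * (1 + b))%:E + (rs k * b)%:E * G n x)%E.

Let H_ge0 k n x : (0 <= H k n x)%E.
Proof.
rewrite adde_ge0 ?lee_fin ?mulr_ge0 ?addr_ge0//.
by rewrite mule_ge0 ?energy_density_ge0// lee_fin mulr_ge0.
Qed.

Let mH k n : measurable_fun Omega (H k n).
Proof.
by apply: emeasurable_funD => //; apply: measurable_funeM;
    exact: measurable_energy_density.
Qed.

Let inner_cell_approx k : exists K, forall n j, exists2 c, `|c| <= K &
  (\int[mu]_(y in inner_cell Omega k j) `|w n y - c|%:E <=
   \int[mu]_(y in inner_cell Omega k j) H k n y)%E.
Proof.
pose q := h k ^+ d; have q0 : 0 < q by rewrite exprn_gt0.
exists (1 + (2 + q) / q / M 1) => n j.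
have [->|[a Qa]] := inner_cell_cube Omega k j.
  by exists 0; rewrite ?integral_set0 ?normr0// addr_ge0// !divr_ge0 ?addr_ge0// ltW.
have mQ := measurable_inner_cell Omega k j.
have muQ : mu (inner_cell Omega k j) = q%:E by rewrite Qa lebesgue_cube// ltW.
have Dh0 : 0 < D * h k by rewrite mulr_gt0.
have diamQ x y : inner_cell Omega k j x -> inner_cell Omega k j y ->
    enorm (x - y) <= D * h k.
  rewrite Qa => xa ya; apply: enorm_le => [|i]; first exact: ltW.
  by rewrite !mxE; exact: (cube_box ya xa).
have [c cK ic] := constant_approximation s0 HM mO mQ (@inner_cell_sub _ _ _ k j)
  q0 muQ Dh0 diamQ (mw n) (Mw n) (Gw n).
exists c => //; apply: le_trans ic _.
suff -> : (D * h k) ^+ d / q / M 1 = b by [].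
rewrite /q exprMn mulfK// gt_eqF//.
Qed.

Let cauchy_on_cell k j n m c c' (eta : R) : 0 <= eta ->
  (\int[mu]_(y in inner_cell Omega k j) `|w n y - c|%:E <=
   \int[mu]_(y in inner_cell Omega k j) H k n y)%E ->
  (\int[mu]_(y in inner_cell Omega k j) `|w m y - c'|%:E <=
   \int[mu]_(y in inner_cell Omega k j) H k m y)%E ->
  `|c - c'| <= eta ->
  (\int[mu]_(y in inner_cell Omega k j) `|w n y - w m y|%:E <=
   \int[mu]_(y in inner_cell Omega k j) (eta%:E + (H k n y + H k m y)))%E.
Proof.
move=> eta0 hn hm cc.
set Q := inner_cell Omega k j in hn hm *.
have mQ : measurable Q by exact: measurable_inner_cell.
have QO : Q `<=` Omega by exact: inner_cell_sub.
have mHQ p : measurable_fun Q (H k p) by exact: measurable_funS (mH k p).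
have mwQ p : measurable_fun Q (w p) by exact: measurable_funS (mw p).
have mnorm (u : 'rV[R]_d -> R) : measurable_fun Q u ->
    measurable_fun Q (fun y => `|u y|%:E).
  move=> mu_; apply/measurable_EFinP.
  exact: (measurableT_comp (@normr_measurable _ setT)).
have mn : measurable_fun Q (fun y => `|w n y - c|%:E).
  by apply: (mnorm (fun y => w n y - c)); exact: measurable_funB.
have mm : measurable_fun Q (fun y => `|w m y - c'|%:E).
  by apply: (mnorm (fun y => w m y - c')); exact: measurable_funB.
rewrite ge0_integralD//; first last.
- exact: emeasurable_funD.
- by move=> y _; rewrite adde_ge0.
rewrite ge0_integralD//.
apply: (@le_trans _ _ (\int[mu]_(y in Q)
    (eta%:E + (`|w n y - c|%:E + `|w m y - c'|%:E)))%E).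
  apply: ge0_le_integral => //.
  - by apply: (mnorm (fun y => w n y - w m y)); exact: measurable_funB.
  - by do 2 apply: emeasurable_funD => //.
  - move=> y _; rewrite -!EFinD lee_fin.
    have -> : w n y - w m y = (c - c') + ((w n y - c) - (w m y - c')) by ring.
    apply: (le_trans (ler_normD _ _)); apply: lerD => //.
    exact: ler_normB.
rewrite ge0_integralD//; first last.
- exact: emeasurable_funD.
- by move=> y _; rewrite -EFinD lee_fin addr_ge0.
rewrite ge0_integralD//; apply: leeD => //; exact: leeD.
Qed.

(** A diagonal argument makes the approximating constants Cauchy on every cell of every mesh. For
    given [e], a fine mesh makes the approximation error small, and finitely many of its cells
    nearly fill [Omega]. *)
Lemma cauchy_subsequence : exists2 phi : nat -> nat, {homo phi : m n / (m < n)%N} &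
  forall e, 0 < e -> exists N, forall n m, (N <= n)%N -> (N <= m)%N ->
    exists E, [/\ measurable E, E `<=` Omega, (mu (Omega `\` E) <= e%:E)%E &
      (\int[mu]_(x in E) `|w (phi n) x - w (phi m) x|%:E <= e%:E)%E].
Proof.
have [K KP] := choice inner_cell_approx.
have [a aP] : {a : nat * nat * nat -> R & forall t, `|a t| <= K t.1.2 /\
    (\int[mu]_(y in inner_cell Omega t.1.2 t.2) `|w t.1.1 y - a t|%:E <=
     \int[mu]_(y in inner_cell Omega t.1.2 t.2) H t.1.2 t.1.1 y)%E}.
  apply: (@choice _ _ (fun t c => `|c| <= K t.1.2 /\
    (\int[mu]_(y in inner_cell Omega t.1.2 t.2) `|w t.1.1 y - c|%:E <=
     \int[mu]_(y in inner_cell Omega t.1.2 t.2) H t.1.2 t.1.1 y)%E)) => -[[n k] j].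
  by have [c c1 c2] := KP k n j; exists c.
(* Mesh and cell are coded in one index; indices that code no pair get the harmless value 0. *)
pose a' n i : R := if unpickle i is Some kj then a (n, kj.1, kj.2) else 0.
pose K' i : R := if unpickle i is Some kj then K (kj : nat * nat).1 else 0.
have [phi phi_lt phiP] : exists2 phi : nat -> nat, {homo phi : m n / (m < n)%N} &
    forall k e, 0 < e -> exists N, forall n m, (N <= n)%N -> (N <= m)%N ->
      forall i, (i < k)%N -> `|a' (phi n) i - a' (phi m) i| <= e.
  apply: (@diagonal_subsequence _ a' K') => n i; rewrite /a' /K'.
  case: unpickle => [[k j]|]; last by rewrite normr0.
  by have [] := aP (n, k, j).
exists phi => // e e0.
pose V := fine (mu Omega).
have V0 : 0 <= V by rewrite fine_ge0.
(* The outer 2 counts the indices [n] and [m]; the inner 2 bounds the integral of the energy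
   density. The product [rs k * A] bounds the total approximation error. *)
pose A := 2 * ((1 + b) * V + b * 2).
have A0 : 0 <= A by rewrite mulr_ge0// addr_ge0// mulr_ge0// addr_ge0.
(* A diameter bound for which [t ^ s * A <= e / 2]; adding 1 keeps the divisor positive. *)
pose t := (e / 2 / (A + 1)) `^ s^-1.
have A1 : 0 < A + 1 by rewrite ltr_wpDl.
have t0 : 0 < t by rewrite powR_gt0// !divr_gt0.
have tsE : t `^ s = e / 2 / (A + 1).
  by rewrite /t -powRrM mulVf ?gt_eqF// powRr1// !divr_ge0// ltW.
have [k [J [Kk muE]]] := inner_cells_exhaust oO Ofin (Num.trunc (D / t)) e0.
have rsk : rs k * A <= e / 2.
  have rt : rs k <= t `^ s.
    apply: ge0_ler_powR; rewrite ?nnegrE ?(ltW s0) ?(ltW t0) ?mulr_ge0 ?(ltW (h0 k)) ?(ltW D0)//.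
    rewrite ler_pdivrMr// -ler_pdivrMl// mulrC.
    apply: (le_trans (ltW (truncnS_gt _))); by rewrite ler_nat ltnS.
  apply: (@le_trans _ _ (t `^ s * A)); first by rewrite ler_wpM2r.
  rewrite tsE mulrAC ler_pdivrMr// ler_wpM2l ?divr_ge0 ?(ltW e0)// lerDl//.
pose eta := e / 2 / (V + 1).
have V1 : 0 < V + 1 by rewrite ltr_wpDl.
have eta0 : 0 < eta by rewrite !divr_gt0.
have etaV : eta * V <= e / 2.
  by rewrite /eta mulrAC ler_pdivrMr// ler_wpM2l ?divr_ge0 ?(ltW e0)// lerDl.
(* Beyond the codes of the finitely many cells used, so one [N] serves all of them. *)
pose L := (\max_(j < J) pickle (k, j : nat)).+1.
have [N NP] := phiP L eta eta0.
exists N => n m Nn Nm; exists (inner_cells Omega k J).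
have mE := measurable_inner_cells Omega k J.
have EO := @inner_cells_sub _ _ Omega k J.
split => //.
have mHE p : measurable_fun (inner_cells Omega k J) (H k p)
    by exact: measurable_funS (mH k p).
have tI : trivIset [set` iota 0 J] (inner_cell Omega k).
  by apply: (@sub_trivIset _ _ _ setT) => //; exact: trivIset_inner_cell.
have mQ j := measurable_inner_cell Omega k j.
rewrite /inner_cells ge0_integral_bigsetU//; first last.
- apply/measurable_EFinP; apply: (measurableT_comp (@normr_measurable _ setT)).
  by apply: measurable_funB; exact: measurable_funS (mw _).
- exact: iota_uniq.
apply: (@le_trans _ _ (\sum_(j <- iota 0 J) \int[mu]_(y in inner_cell Omega k j)
    (eta%:E + (H k (phi n) y + H k (phi m) y)))%E).
  rewrite !big_seq; apply: lee_sum => j; rewrite mem_iota add0n => /andP[_ jJ].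
  have [_ an] := aP (phi n, k, j); have [_ am] := aP (phi m, k, j).
  apply: (cauchy_on_cell (ltW eta0) an am).
  have := NP n m Nn Nm (pickle (k, j)); rewrite /a' pickleK; apply.
  by rewrite /L ltnS (leq_bigmax (Ordinal jJ)).
rewrite -ge0_integral_bigsetU//; first last.
- by move=> y _; apply: adde_ge0; [rewrite lee_fin ltW|exact: adde_ge0].
- by apply: emeasurable_funD => //; exact: emeasurable_funD.
- exact: iota_uniq.
rewrite -/(inner_cells Omega k J).
apply: (@le_trans _ _ (\int[mu]_(y in Omega) (eta%:E + (H k (phi n) y + H k (phi m) y)))%E).
  apply: ge0_subset_integral => //.
  - by apply: emeasurable_funD => //; exact: emeasurable_funD.
  - by move=> y _; apply: adde_ge0; [rewrite lee_fin ltW|exact: adde_ge0].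
have VE : mu Omega = V%:E by rewrite /V fineK// ge0_fin_numE.
have icst (c : R) : (\int[mu]_(y in Omega) cst c%:E y = (c * V)%:E)%E.
  by transitivity (c%:E * mu Omega)%E; [exact: integral_cst|rewrite VE EFinM].
rewrite ge0_integralD//; first last.
- exact: emeasurable_funD.
- by move=> y _; rewrite adde_ge0.
- by move=> y _; rewrite lee_fin ltW.
rewrite ge0_integralD//.
have IH p : (\int[mu]_(y in Omega) H k p y <= (rs k * ((1 + b) * V + b * 2))%:E)%E.
  rewrite ge0_integralD//; first last.
  - by apply: measurable_funeM; exact: measurable_energy_density.
  - by move=> y _; rewrite mule_ge0 ?energy_density_ge0// lee_fin mulr_ge0.
  - by move=> y _; rewrite lee_fin mulr_ge0// addr_ge0.
  have rb0 : 0 <= rs k * b by exact: mulr_ge0.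
  rewrite (ge0_integralZl_EFin _ _ _ _ rb0)//; first last.
  - exact: measurable_energy_density.
  - by move=> y _; exact: energy_density_ge0.
  apply: (@le_trans _ _ ((rs k * (1 + b) * V)%:E + (rs k * b)%:E * 2%:E)%E).
    rewrite icst; apply: leeD2l; apply: lee_wpmul2l; first by rewrite lee_fin.
    exact: integral_energy_density.
  rewrite -EFinM -EFinD lee_fin le_eqVlt; apply/orP; left; apply/eqP; ring.
rewrite icst; apply: (@le_trans _ _ (e / 2 + e / 2)%:E); last by rewrite -splitr.
rewrite EFinD; apply: leeD; first by rewrite lee_fin.
apply: (le_trans (leeD (IH _) (IH _))); rewrite -EFinD lee_fin.
by move: rsk; rewrite /A; lra.
Qed.

End cauchy_subsequence.

(** * Almost everywhere convergent subsequences *)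

Section riesz.
Context {dd : measure_display} {T : measurableType dd} {R : realType}.
Variable mu : {measure set T -> \bar R}.
Variable D : set T.
Hypothesis mD : measurable D.
Variable f : nat -> T -> R.
Hypothesis mf : forall n, measurable_fun D (f n).

Let diff_ge n m (eta : R) : set T := D `&` [set x | eta <= `|f n x - f m x|].

Let mdiff_norm n m : measurable_fun D (fun x => `|f n x - f m x|).
Proof.
apply: (measurableT_comp (@normr_measurable _ setT)).
exact: measurable_funB.
Qed.

Let mdiff n m eta : measurable (diff_ge n m eta).
Proof. exact: measurable_fun_le. Qed.

Lemma cauchy_in_measure :
  (forall e : R, 0 < e -> exists N, forall n m, (N <= n)%N -> (N <= m)%N ->
    exists E, [/\ measurable E, E `<=` D, (mu (D `\` E) <= e%:E)%E &
      (\int[mu]_(x in E) `|f n x - f m x|%:E <= e%:E)%E]) ->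
  forall eta e : R, 0 < eta -> 0 < e -> exists N, forall n m, (N <= n)%N ->
      (N <= m)%N ->
    (mu (D `&` [set x | (eta <= `|f n x - f m x|)%R]) <= e%:E)%E.
Proof.
(* The factor 1 bounds the measure outside [E] by [e / 2]; the factor [eta] is absorbed by Markov's
   inequality on [E]. *)
move=> cf eta e eta0 e0; pose e' := e / 2 * Num.min 1 eta.
have m0 : 0 < Num.min 1 eta by rewrite lt_min ltr01.
have e'0 : 0 < e' by rewrite mulr_gt0// divr_gt0.
have [N NP] := cf e' e'0; exists N => n m Nn Nm.
have [E [mE ED DE iE]] := NP n m Nn Nm.
have e2 : 0 <= e / 2 by rewrite divr_ge0// ltW.
have h1 : (mu (D `\` E) <= (e / 2)%:E)%E.
  by apply: (le_trans DE); rewrite lee_fin ler_piMr// ge_min lexx.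
have mEd : measurable (E `&` diff_ge n m eta) by exact: measurableI.
have h2 : (mu (E `&` diff_ge n m eta) <= (e / 2)%:E)%E.
  have : (eta%:E * mu (E `&` diff_ge n m eta) <= e'%:E)%E.
    apply: le_trans iE; apply: integral_ge_measure => //; last exact: ltW.
    - by apply/measurable_EFinP; exact: measurable_funS (mdiff_norm n m).
    - by move=> x [_ [_ /=]]; rewrite lee_fin.
  rewrite -lee_pdivlMl// => /le_trans; apply.
  rewrite -EFinM lee_fin ler_pdivrMl// /e' mulrC ler_wpM2r//.
  by rewrite ge_min lexx orbT.
apply: (@le_trans _ _ (mu ((D `\` E) `|` (E `&` diff_ge n m eta)))).
  apply: le_measure; rewrite ?inE//.
  - exact: mdiff.
  - by apply: measurableU => //; exact: measurableD.
  - move=> x [Dx xe]; have [Ex|nEx] := pselect (E x); first by right.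
    by left.
apply: (le_trans (measureU2 mu (measurableD mD mE) mEd)).
by rewrite (splitr e) EFinD; exact: leeD.
Qed.

Hypothesis cauchy_f : forall eta e : R, 0 < eta -> 0 < e ->
  exists N, forall n m, (N <= n)%N -> (N <= m)%N ->
    (mu (D `&` [set x | (eta <= `|f n x - f m x|)%R]) <= e%:E)%E.

(** Riesz's argument: consecutive terms differ by at least [2^-(k+1)] only on sets of summable
    measure, so by Borel-Cantelli the sequence is Cauchy outside a null set. *)
Lemma ae_convergent_subsequence : exists psi : nat -> nat, exists v : T -> R,
  exists N : set T,
  [/\ {homo psi : m n / (m < n)%N}, measurable_fun D v, measurable N, mu N = 0 &
    forall x, D x -> ~ N x -> f (psi n) x @[n --> \oo] --> v x].
Proof.
pose g (k : nat) : R := 1 / (2 ^ k.+1)%:R.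
have g0 k : 0 < g k by rewrite divr_gt0// ltr0n expn_gt0.
have gE k : g k = 2 * g k.+1.
  rewrite /g (expnS _ k.+1) natrM; field.
  by rewrite pnatr_eq0 -lt0n expn_gt0.
have gsmall e : 0 < e -> exists k, g k <= e.
  move=> e0; exists (Num.trunc e^-1);
      rewrite /g div1r invf_ple ?posrE ?ltr0n ?expn_gt0//.
  apply: (le_trans (ltW (truncnS_gt _))); rewrite ler_nat.
  exact/ltnW/ltn_expl.
have [psi [psi_lt psiP]] := @increasing_choice (fun k n => forall m, (n <= m)%N ->
    (mu (diff_ge n m (g k)) <= (g k)%:E)%E) (fun k N =>
  let: ex_intro N' HN' := cauchy_f (g0 k) (g0 k) in
  ex_intro _ (maxn N N') (conj (leq_maxl _ _) (fun m hm =>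
    HN' _ m (leq_maxr _ _) (leq_trans (leq_maxr _ _) hm)))).
pose F k := diff_ge (psi k) (psi k.+1) (g k).
have mF k : measurable (F k) by exact: mdiff.
have mlim : mu (lim_sup_set F) = 0.
  apply: lim_sup_set_cvg0 => //.
  apply: (@le_lt_trans _ _ 1%E); last exact: ltry.
  apply: le_trans (epsilon_trick0 xpredT (@ler01 R)).
  apply: lee_nneseries => // k _; apply: psiP.
  by apply: ltnW; exact: psi_lt.
have mN : measurable (lim_sup_set F).
  apply: bigcapT_measurable => n; apply: bigcup_measurable => k _; exact: mF.
(* An upper limit is measurable on all of [D], and agrees with the limit wherever there is one. *)
exists psi, (fun x => fine (limn_esup (fun n => (f (psi n) x)%:E))), (lim_sup_set F).
split => //.
  apply: (measurableT_comp (@fine_measurable _ _ measurableT)).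
  apply: measurable_fun_limn_esup => n; exact/measurable_EFinP.
move=> x Dx nx.
have [K HK] : exists K, forall k, (K <= k)%N ->
    `|f (psi k) x - f (psi k.+1) x| < g k.
  apply: contrapT => h; apply: nx => K _; apply: contrapT => h'; apply: h.
  exists K => k Kk; rewrite ltNge; apply/negP => gk; apply: h'.
  by exists k.
(* Telescoping, with [g k = 2 * g k.+1] summing the geometric tail. *)
have tail k j : (K <= k)%N -> `|f (psi k) x - f (psi (k + j)%N) x| <= 2 * g k.
  elim: j k => [|j IH] k Kk.
    by rewrite addn0 subrr normr0 mulr_ge0// ltW.
  rewrite -(subrKA (f (psi k.+1) x)); apply: (le_trans (ler_normD _ _)).
  have := HK k Kk; have := IH k.+1 (leqW Kk); rewrite addSnnS -gE.
  move=> h1 h2; lra.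
have cv : cvgn (fun n => f (psi n) x).
  apply: cauchy_cvg; apply: cauchy_exP => e e0.
  have e40 : 0 < e / 4 by rewrite divr_gt0.
  have [k gk] := gsmall _ e40.
  pose k' := maxn k K.
  have gk' : g k' <= e / 4.
    apply: le_trans gk; rewrite /g !div1r lef_pV2 ?posrE ?ltr0n ?expn_gt0//.
    by rewrite ler_nat leq_exp2l// ltnS leq_maxl.
  exists (f (psi k') x); exists k' => // n /= kn; rewrite -ball_normE/=.
  have := tail k' (n - k')%N (leq_maxr _ _); rewrite subnKC// => h.
  by apply: (le_lt_trans h); lra.
have /cvg_limn_einf_sup[_ ->] : (f (psi n) x)%:E @[n --> \oo] --> (limn (fun n => f (psi n) x))%:E.
  by apply: cvg_EFin; [near=> n|].
exact: cv.
Unshelve. all: by end_near. Qed.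

End riesz.

Lemma limn_einf_le (R : realType) (u : (\bar R)^nat) (l : \bar R) :
  (forall n, u n <= l)%E -> (limn_einf u <= l)%E.
Proof.
move=> ul; apply: (le_trans (limn_einf_sup u)).
rewrite limn_esup_lim; apply: lime_le; first exact: is_cvg_esups.
by near=> n; apply: ge_ereal_sup => _ [k _ <-].
Unshelve. all: by end_near. Qed.

(** * Consequences of essential domination *)

Section dominated_nfunction.
Context {dd : measure_display} {T : measurableType dd} {R : realType}.
Variable mu : {measure set T -> \bar R}.
Variables (D : set T) (A B : R -> R).
Hypothesis mD : measurable D.
Hypothesis Dfin : (mu D < +oo)%E.
Hypothesis A_le : forall x y, `|x| <= `|y| -> A x <= A y.
Hypothesis A_ge0 : forall x, 0 <= A x.
Hypothesis AZ : forall k x, 0 <= k <= 1 -> A (k * x) <= k * A x.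
Hypothesis mA : measurable_fun setT A.
Hypothesis HB : nfunction B.
Hypothesis BA : ndominated B A.

Let V := fine (mu D).
Let V0 : 0 <= V. Proof. exact: fine_ge0. Qed.
Let VE : mu D = V%:E. Proof. by rewrite /V fineK// ge0_fin_numE. Qed.

Let BA_norm a : 0 < a -> exists2 xa, 0 <= xa & forall x, xa <= `|x| ->
    B x <= A (a * x).
Proof.
move=> a0; have [xa xa0 h] := BA a0; exists xa => // x /h;
    rewrite (nfunction_norm HB).
by move=> /le_trans; apply; apply: A_le; rewrite !normrM normr_id.
Qed.

Let icst (c : R) : (\int[mu]_(y in D) cst c%:E y = (c * V)%:E)%E.
Proof. by transitivity (c%:E * mu D)%E; [exact: integral_cst|rewrite VE EFinM]. Qed.

Let mB (g : T -> R) : measurable_fun D g ->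
    measurable_fun D (fun x => (B (g x))%:E).
Proof.
move=> mg; apply/measurable_EFinP.
exact: (measurableT_comp (continuous_measurable_fun (@nfunction_continuous _ _ HB)) mg).
Qed.

Let mA' (g : T -> R) : measurable_fun D g ->
    measurable_fun D (fun x => (A (g x))%:E).
Proof. by move=> mg; apply/measurable_EFinP; exact: (measurableT_comp mA mg). Qed.

(** Domination with [a = 1] gives [B <= B x1 + A] pointwise, so the modular of [B] is at most [K];
    convexity at the origin divides it by [K]. *)
Lemma dominated_modular_bound : exists2 K, 1 <= K & forall g : T -> R,
  measurable_fun D g -> (\int[mu]_(x in D) (A (g x))%:E <= 1)%E ->
  (\int[mu]_(x in D) (B (K^-1 * g x))%:E <= 1)%E.
Proof.
have [x1 x10 hx1] := BA_norm ltr01.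
have B1 := nfunction_ge0 HB x1.
pose K := 1 + B x1 * V; have K1 : 1 <= K by rewrite lerDl mulr_ge0.
have K0 : 0 < K by lra.
exists K => // g mg Ag.
have ptw x : B (g x) <= B x1 + A (g x).
  have [h|h] := leP x1 `|g x|.
    by apply: (le_trans (hx1 _ h)); rewrite mul1r lerDr.
  apply: (@le_trans _ _ (B x1)); last by rewrite lerDl.
  by apply: (nfunction_le_norm HB); rewrite (ger0_norm x10) ltW.
have mKg : measurable_fun D (fun x => K^-1 * g x) by exact: measurable_funM.
have KI : 0 <= K^-1 <= 1 by rewrite invr_ge0 invf_le1// K1 ltW.
have Ki : 0 <= K^-1 by case/andP: KI.
apply: (@le_trans _ _ (\int[mu]_(x in D) (K^-1%:E * ((B x1)%:E + (A (g x))%:E)))%E).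
  apply: ge0_le_integral => //.
  - by move=> x _; rewrite lee_fin (nfunction_ge0 HB).
  - exact: mB.
  - by apply: measurable_funeM; apply: emeasurable_funD => //; exact: mA'.
  - move=> x _; rewrite -EFinD -EFinM lee_fin;
        apply: (le_trans (nfunctionZ_le HB _ KI)).
    by rewrite ler_wpM2l.
rewrite (ge0_integralZl_EFin _ _ _ _ Ki)//; first last.
- by apply: emeasurable_funD => //; exact: mA'.
- by move=> x _; rewrite -EFinD lee_fin addr_ge0.
rewrite ge0_integralD//; first last.
- exact: mA'.
- by move=> x _; rewrite lee_fin.
rewrite icst lee_pdivrMl// mule1.
have -> : K%:E = ((B x1 * V)%:E + 1)%E by rewrite /K addrC EFinD.
exact: leeD2l.
Qed.

(** The scaled difference is split by size. Where it is below [k], [B] contributes at most 1/4;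
    between [k] and [xa] the set has small measure and contributes 1/4; above [xa], domination by
    [A] contributes at most 1/2. *)
Lemma dominated_cauchy (f : nat -> T -> R) (C : R) : 0 < C ->
  (forall n, measurable_fun D (f n)) ->
  (forall n, \int[mu]_(x in D) (A (C^-1 * f n x))%:E <= 1)%E ->
  (forall eta e : R, 0 < eta -> 0 < e -> exists N, forall n m, (N <= n)%N ->
      (N <= m)%N ->
    (mu (D `&` [set x | (eta <= `|f n x - f m x|)%R]) <= e%:E)%E) ->
  forall e : R, 0 < e -> exists N, forall n m, (N <= n)%N -> (N <= m)%N ->
    (\int[mu]_(x in D) (B (e^-1 * (f n x - f m x)))%:E <= 1)%E.
Proof.
move=> C0 mf Af cf e e0.
(* Cancels the scaling by [e^-1] and leaves [1 / 4 * (2 * C)^-1]: the 1/4 comes out of [A] by [AZ],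
   and [(2 * C)^-1] matches the modular bound. *)
pose a := e * (1 / 4 / (2 * C)).
have a0 : 0 < a by rewrite mulr_gt0// !divr_gt0// mulr_gt0.
have [xa xa0 hxa] := BA_norm a0.
have Bx0 := nfunction_ge0 HB xa.
have B10 := nfunction_ge0 HB 1.
pose k := Num.min 1 (1 / 4 / (B 1 * V + 1)).
have BV1 : 0 < B 1 * V + 1 by rewrite ltr_wpDl// mulr_ge0.
have k0 : 0 < k by rewrite lt_min ltr01/= !divr_gt0.
have k1 : k <= 1 by rewrite ge_min lexx.
have kI : 0 <= k <= 1 by rewrite k1 ltW.
have Bk : B k * V <= 1 / 4.
  have h1 : B k <= k * B 1 by rewrite -{1}(mulr1 k); exact: (nfunctionZ_le HB).
  have h2 : k * (B 1 * V + 1) <= 1 / 4.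
    by rewrite -ler_pdivlMr// ge_min lexx orbT.
  have h3 : B k * V <= k * B 1 * V by rewrite ler_wpM2r.
  lra.
pose r := 1 / 4 / (B xa + 1).
have Bx1 : 0 < B xa + 1 by rewrite ltr_wpDl.
have r0 : 0 < r by rewrite !divr_gt0.
have rE : B xa * r <= 1 / 4.
  rewrite /r mulrA ler_pdivrMr//; lra.
have [N NP] := cf (e * k) r (mulr_gt0 e0 k0) r0.
exists N => n m Nn Nm.
pose S := D `&` [set x | e * k <= `|f n x - f m x|].
have mnorm : measurable_fun D (fun x => `|f n x - f m x|).
  by apply: (measurableT_comp (@normr_measurable _ setT)); exact: measurable_funB.
have mS : measurable S by exact: measurable_fun_le.
have muS : (mu S <= r%:E)%E by exact: NP.
have mfC p : measurable_fun D (fun x => C^-1 * f p x) by exact: measurable_funM.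
have far x : xa <= `|e^-1 * (f n x - f m x)| ->
    B (e^-1 * (f n x - f m x)) <= 1 / 4 * (A (C^-1 * f n x) + A (C^-1 * f m x)).
  move=> /hxa /le_trans; apply.
  have -> : a * (e^-1 * (f n x - f m x)) = 1 / 4 * ((2 * C)^-1 * (f n x - f m x)).
    by rewrite /a; field; rewrite (gt_eqF e0) (gt_eqF C0).
  apply: (le_trans (AZ _ _)); first by apply/andP; split; lra.
  rewrite ler_wpM2l//.
  have Ci : 0 < (2 * C)^-1 by rewrite invr_gt0 mulr_gt0.
  have Ci' : 0 < C^-1 by rewrite invr_gt0.
  (* Half a difference is bounded by the larger of the two terms, so monotonicity of [A] in the
     absolute value does the work of convexity. *)
  have half (y z : R) : `|y| <= `|z| -> `|(2 * C)^-1 * (y - z)| <= `|C^-1 * z|.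
    move=> yz; rewrite !normrM (gtr0_norm Ci) (gtr0_norm Ci') invfM mulrAC.
    rewrite (mulrC (2^-1 * _)) ler_wpM2l ?(ltW Ci')//.
    have := ler_normB y z; lra.
  have [le|/ltW le] := leP `|f n x| `|f m x|.
    apply: (@le_trans _ _ (A (C^-1 * f m x))); last by rewrite lerDr.
    exact/A_le/half.
  apply: (@le_trans _ _ (A (C^-1 * f n x))); last by rewrite lerDl.
  by apply: A_le; rewrite -(opprB (f m x)) mulrN normrN; exact: half.
have ptw x : D x -> B (e^-1 * (f n x - f m x)) <=
    B k + (B xa * \1_S x + 1 / 4 * (A (C^-1 * f n x) + A (C^-1 * f m x))).
  move=> Dx; have i0 : 0 <= (\1_S x : R) by rewrite indicE.
  have s0 : 0 <= B xa * \1_S x by rewrite mulr_ge0.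
  have A0 : 0 <= 1 / 4 * (A (C^-1 * f n x) + A (C^-1 * f m x)).
    by rewrite mulr_ge0// addr_ge0.
  have Bk0 := nfunction_ge0 HB k.
  have [h|h] := leP xa `|e^-1 * (f n x - f m x)|; first by have := far x h; lra.
  have ei : 0 < e^-1 by rewrite invr_gt0.
  have [Sx|nSx] := pselect (S x).
    rewrite indicE mem_set// mulr1.
    have : B (e^-1 * (f n x - f m x)) <= B xa.
      by apply: (nfunction_le_norm HB); rewrite (ger0_norm xa0) ltW.
    lra.
  have : B (e^-1 * (f n x - f m x)) <= B k.
    apply: (nfunction_le_norm HB); rewrite (gtr0_norm k0) normrM (gtr0_norm ei).
    rewrite ler_pdivrMl// leNgt; apply/negP => /ltW hh; apply: nSx.
    by split.
  lra.
have mAA : measurable_fun D (fun x => ((A (C^-1 * f n x))%:E + (A (C^-1 * f m x))%:E)%E).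
  by apply: emeasurable_funD; exact: mA'.
have mind : measurable_fun D (fun x => (\1_S x)%:E : \bar R).
  by apply/measurable_EFinP; exact: measurable_indic.
have AA0 x : D x -> (0 <= (A (C^-1 * f n x))%:E + (A (C^-1 * f m x))%:E)%E.
  by move=> _; rewrite -EFinD lee_fin addr_ge0.
have q0 : 0 <= (1 / 4 : R) by lra.
apply: (@le_trans _ _ (\int[mu]_(x in D) (cst (B k)%:E x + ((B xa)%:E * (\1_S x)%:E +
    (1 / 4)%:E * ((A (C^-1 * f n x))%:E + (A (C^-1 * f m x))%:E))))%E).
  apply: ge0_le_integral => //.
  - by move=> x _; rewrite lee_fin (nfunction_ge0 HB).
  - apply: mB; apply: measurable_funM => //; exact: measurable_funB.
  - by do 2 (apply: emeasurable_funD => //; last try exact: measurable_funeM);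
      exact: measurable_funeM.
rewrite ge0_integralD//; first last.
- by apply: emeasurable_funD; exact: measurable_funeM.
- move=> x Dx; apply: adde_ge0; first by rewrite -EFinM lee_fin mulr_ge0// indicE.
  by rewrite mule_ge0// AA0.
- by move=> x _; rewrite lee_fin (nfunction_ge0 HB).
rewrite ge0_integralD//; first last.
- exact: measurable_funeM.
- by move=> x Dx; rewrite mule_ge0// AA0.
- exact: measurable_funeM.
- by move=> x _; rewrite -EFinM lee_fin mulr_ge0// indicE.
rewrite (ge0_integralZl_EFin _ _ _ _ Bx0)//.
rewrite (ge0_integralZl_EFin _ _ _ _ q0)//.
rewrite ge0_integralD//; first last.
- exact: mA'.
- by move=> x _; rewrite lee_fin.
- exact: mA'.
- by move=> x _; rewrite lee_fin.
rewrite icst integral_indic//.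
have -> : S `&` D = S by apply/setIidPl => x [].
apply: (@le_trans _ _ ((1 / 4)%:E + ((1 / 4)%:E + (1 / 4)%:E * (1 + 1)))%E).
  apply: leeD; first by rewrite lee_fin.
  apply: leeD.
    apply: (@le_trans _ _ ((B xa)%:E * r%:E)%E); first exact: lee_wpmul2l.
    by rewrite -EFinM lee_fin.
  by apply: lee_wpmul2l; [rewrite lee_fin|exact: leeD].
have -> : (1 + 1 = 2%:E :> \bar R)%E by rewrite -EFinD.
by rewrite -EFinM -!EFinD lee_fin; lra.
Qed.

End dominated_nfunction.

(** * Differences and limits in Orlicz spaces *)

Section orlicz_limits.
Variables (R : realType) (d : nat) (B : R -> R) (Omega : set 'rV[R]_d).
Hypothesis HB : nfunction B.
Hypothesis mO : measurable Omega.
Local Notation mu := (lebesgue_rV d).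
Implicit Types u v : 'rV[R]_d -> R.

Lemma orlicz_spaceB u v : orlicz_space B Omega u -> orlicz_space B Omega v ->
  orlicz_space B Omega (u \- v).
Proof.
move=> [mu_ [l1 l10 lu]] [mv_ [l2 l20 lv]]; split; first exact: measurable_funB.
pose l := Num.min l1 l2 / 2.
have m0 : 0 < Num.min l1 l2 by rewrite lt_min l10 l20.
have l0 : 0 < l by rewrite divr_gt0.
have ll1 : 2 * l <= l1 by rewrite /l mulrC divfK// ge_min lexx.
have ll2 : 2 * l <= l2 by rewrite /l mulrC divfK// ge_min lexx orbT.
exists l => //; apply: (@le_lt_trans _ _
    (orlicz_modular B Omega (l1 \*o u) + orlicz_modular B Omega (l2 \*o v))%E); last first.
  exact: lte_add_pinfty.
have m1 : measurable_fun Omega (fun x => (B ((l1 \*o u) x))%:E).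
  by apply: nfunction_measurable_comp => //; exact: measurable_funM.
have m2 : measurable_fun Omega (fun x => (B ((l2 \*o v) x))%:E).
  by apply: nfunction_measurable_comp => //; exact: measurable_funM.
rewrite /orlicz_modular -ge0_integralD//; first last.
- by move=> x _; rewrite lee_fin (nfunction_ge0 HB).
- by move=> x _; rewrite lee_fin (nfunction_ge0 HB).
apply: ge0_le_integral => //.
- by move=> x _; rewrite lee_fin (nfunction_ge0 HB).
- apply: nfunction_measurable_comp => //; apply: measurable_funM => //.
  exact: measurable_funB.
- exact: emeasurable_funD.
move=> x _; rewrite -EFinD lee_fin /=.
have half (y z k : R) : 2 * l <= k -> `|y| <= `|z| -> `|l * (y - z)| <= `|k * z|.
  move=> lk yz; have k0 : 0 < k by lra.
  rewrite (normrM l) (normrM k) (gtr0_norm l0) (gtr0_norm k0).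
  apply: (@le_trans _ _ (l * (2 * `|z|))).
    by rewrite ler_wpM2l ?(ltW l0)//; have := ler_normB y z; lra.
  by rewrite mulrA (mulrC l) ler_wpM2r.
have B1 := nfunction_ge0 HB (l1 * u x); have B2 := nfunction_ge0 HB (l2 * v x).
have [le|/ltW le] := leP `|u x| `|v x|.
  by have := nfunction_le_norm HB (half _ _ _ ll2 le); lra.
have := nfunction_le_norm HB (half _ _ _ ll1 le).
by rewrite -opprB mulrN (nfunction_even HB); lra.
Qed.

(** Fatou's lemma outside the null set, where continuity of [B] gives convergence of the
    integrands. *)
Lemma modular_limit (f : nat -> 'rV[R]_d ->
    R) v (N : set 'rV[R]_d) (g : 'rV[R]_d -> R) (k : R) :
  (forall n, measurable_fun Omega (f n)) -> measurable_fun Omega v ->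
  measurable_fun Omega g -> measurable N -> mu N = 0%E ->
  (forall x, Omega x -> ~ N x -> f n x @[n --> \oo] --> v x) ->
  (forall n, \int[mu]_(x in Omega) (B (k * (g x - f n x)))%:E <= 1)%E ->
  (\int[mu]_(x in Omega) (B (k * (g x - v x)))%:E <= 1)%E.
Proof.
move=> mf mv mg mN N0 fv fB.
have mBk (w : 'rV[R]_d -> R) : measurable_fun Omega w ->
    measurable_fun Omega (fun x => (B (k * (g x - w x)))%:E).
  move=> mw; apply: nfunction_measurable_comp => //.
  by apply: measurable_funM => //; exact: measurable_funB.
have mON : measurable (Omega `\` N) by exact: measurableD.
have B0 x : (0 <= (B x)%:E)%E by rewrite lee_fin (nfunction_ge0 HB).
rewrite (ge0_negligible_integral _ _ _ _ N0)//; last exact: mBk.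
have -> : (\int[mu]_(x in Omega `\` N) (B (k * (g x - v x)))%:E =
    \int[mu]_(x in Omega `\` N) limn_einf (fun n => (B (k * (g x - f n x)))%:E))%E.
  apply: eq_integral => x; rewrite inE => -[Ox nNx].
  have cv : (B (k * (g x - f n x)))%:E @[n --> \oo] --> (B (k * (g x - v x)))%:E.
    apply: cvg_EFin; first by near=> n.
    apply: (@continuous_cvg _ _ _ _ _ _ B);
        first exact: (@nfunction_continuous _ _ HB).
    apply: cvgM; first exact: cvg_cst.
    by apply: cvgB; [exact: cvg_cst|exact: fv].
  by have [-> _] := cvg_limn_einf_sup cv.
apply: (le_trans (fatou _ _ _ _)) => //.
  by move=> n; apply: measurable_funS (mBk _ (mf n)) => // x [].
apply: limn_einf_le => n; apply: le_trans (fB n).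
by apply: ge0_subset_integral => //; exact: mBk.
Unshelve. all: by end_near. Qed.

End orlicz_limits.

(** * The compact embedding *)

Section compactness.
Variables (R : realType) (d : nat) (s : R) (M A B : R -> R) (Omega : set 'rV[R]_d).
Hypothesis d0 : (0 < d)%N.
Hypothesis s0 : 0 < s.
Hypothesis HM : nfunction M.
Hypothesis oO : open Omega.
Local Notation mu := (lebesgue_rV d).
Hypothesis Ofin : (mu Omega < +oo)%E.
Hypothesis A_le : forall x y, `|x| <= `|y| -> A x <= A y.
Hypothesis A_ge0 : forall x, 0 <= A x.
Hypothesis AZ : forall k x, 0 <= k <= 1 -> A (k * x) <= k * A x.
Hypothesis mA : measurable_fun setT A.
Hypothesis HB : nfunction B.
Hypothesis BA : ndominated B A.
Variable C : R.
Hypothesis C0 : 0 < C.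
Hypothesis modular_bound : forall u : 'rV[R]_d -> R,
  measurable_fun Omega u -> (orlicz_modular M Omega u <= 1)%E ->
  (gagliardo_modular s M Omega u <= 1)%E ->
  (orlicz_modular A Omega (C^-1 \*o u) <= 1)%E.
Let mO : measurable Omega. Proof. exact: open_measurable_rV. Qed.

Lemma dominated_continuous_embedding :
  continuous_embedding (frac_sobolev_space s M Omega) (frac_sobolev_norm s M Omega)
    (orlicz_space B Omega) (luxemburg_norm B Omega).
Proof.
have [K K1 KP] := dominated_modular_bound mO Ofin A_le A_ge0 mA HB BA.
have K0 : 0 < K by lra.
apply: (continuous_embedding_modular HM mO (mulr_gt0 C0 K0)) => u mu_ Mu Gu.
rewrite mulrC invfM -scale_scale; apply: KP; first exact: measurable_funM.
exact: modular_bound.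
Qed.

Lemma dominated_compact_embedding :
  compact_embedding (frac_sobolev_space s M Omega) (frac_sobolev_norm s M Omega)
    (orlicz_space B Omega) (luxemburg_norm B Omega).
Proof.
have emb := dominated_continuous_embedding; split=> // u Xu [K uK].
have mu_ n : measurable_fun Omega (u n) by have [[]] := Xu n.
(* Strictly above [K], as [frac_sobolev_norm_lt] requires, and positive whatever the sign of [K]. *)
pose L := `|K| + 1; have L0 : 0 < L by rewrite ltr_wpDl.
have Li : 0 < L^-1 by rewrite invr_gt0.
pose w n := L^-1 \*o u n.
have mw n : measurable_fun Omega (w n) by exact: measurable_funM.
have uL n : (frac_sobolev_norm s M Omega (u n) < L%:E)%E.
  by apply: (le_lt_trans (uK n)); rewrite lte_fin /L; have := ler_norm K; lra.
have Mw n : (orlicz_modular M Omega (w n) <= 1)%E.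
  by have [] := frac_sobolev_norm_lt HM mO (mu_ n) L0 (uL n).
have Gw n : (gagliardo_modular s M Omega (w n) <= 1)%E.
  by have [] := frac_sobolev_norm_lt HM mO (mu_ n) L0 (uL n).
have [phi phi_lt cau1] := cauchy_subsequence d0 s0 HM oO Ofin mw Mw Gw.
have cau := cauchy_in_measure mO (fun n => mw (phi n)) cau1.
have [psi [v [N [psi_lt mv mN N0 wv]]]] :=
  ae_convergent_subsequence mO (fun n => mw (phi n)) cau.
have Aw n : (orlicz_modular A Omega (C^-1 \*o w (phi n)) <= 1)%E.
  exact: modular_bound.
have Bcau := dominated_cauchy mO Ofin A_le A_ge0 AZ mA HB BA C0
  (fun n => mw (phi n)) Aw cau.
have Blim e : 0 < e -> exists n0, forall n, (n0 <= n)%N ->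
    (\int[mu]_(x in Omega) (B (e^-1 * (w (phi (psi n)) x - v x)))%:E <= 1)%E.
  move=> e0; have [n0 n0P] := Bcau e e0; exists n0 => n n0n.
  (* The first index stays fixed while the second goes to infinity; the shift by [n0] makes the
     Cauchy bound hold for every term. *)
  apply: (@modular_limit _ _ B Omega HB mO (fun m => w (phi (psi (n0 + m)%N))) v N) => //.
    move=> x Ox nNx; have := wv x Ox nNx.
    rewrite -(cvg_shiftn n0); apply: cvg_trans; apply: near_eq_cvg.
    by near=> m; rewrite addnC.
  move=> m; apply: n0P; first by apply: (leq_trans n0n); exact: increasing_ge.
  by apply: (leq_trans (leq_addr m n0)); exact: increasing_ge.
have mLv : measurable_fun Omega (L \*o v) by exact: measurable_funM.
have scaleE e n x : (L * e)^-1 * (u n x - L * v x) = e^-1 * (w n x - v x).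
  by rewrite /w/= invfM mulrAC mulrBr mulKf ?gt_eqF// mulrC.
have lim0 e : 0 < e -> exists n0, forall n, (n0 <= n)%N ->
    (luxemburg_norm B Omega (u (phi (psi n)) \- (L \*o v))%R <= (L * e)%:E)%E.
  move=> e0; have [n0 n0P] := Blim e e0; exists n0 => n n0n.
  apply: ereal_inf_lbound; exists (L * e) => //; split;
      first by rewrite /= mulr_gt0.
  apply: le_trans (n0P n n0n).
  by rewrite /orlicz_modular/=; under eq_integral do rewrite scaleE.
exists (phi \o psi), (L \*o v); split.
- by move=> m n mn /=; apply: phi_lt; exact: psi_lt.
(* The limit is a term of the sequence minus its difference to the limit; both lie in the Orlicz
   space, the latter by the modular bound at [e = 1]. *)
- have [n0 n0P] := Blim 1 ltr01.
  have u0 : orlicz_space B Omega (u (phi (psi n0))) by exact: emb.1.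
  have -> : L \*o v = u (phi (psi n0)) \- (u (phi (psi n0)) \- (L \*o v)).
    by apply/funext => x /=; rewrite opprB addrC subrK.
  apply: orlicz_spaceB => //; split; first exact: measurable_funB.
  exists (L * 1)^-1; first by rewrite invr_gt0 mulr_gt0.
  apply: (@le_lt_trans _ _ 1%E); last exact: ltry.
  apply: le_trans (n0P n0 (leqnn _)).
  by rewrite /orlicz_modular/=; under eq_integral do rewrite scaleE.
- apply/fine_cvgP; split.
    have [n0 n0P] := lim0 1 ltr01; exists n0 => // n /= n0n.
    rewrite ge0_fin_numE ?luxemburg_norm_ge0//.
    by apply: (le_lt_trans (n0P n n0n)); exact: ltry.
  apply/cvgrPdist_le => e e0; have eL : 0 < e / L by rewrite divr_gt0.
  have [n0 n0P] := lim0 _ eL; exists n0 => // n /= n0n.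
  rewrite sub0r normrN ger0_norm ?fine_ge0 ?luxemburg_norm_ge0//.
  have := n0P n n0n; rewrite mulrC divfK ?gt_eqF// => h.
  rewrite -lee_fin fineK// ge0_fin_numE ?luxemburg_norm_ge0//.
  by apply: (le_lt_trans h); exact: ltry.
Unshelve. all: by end_near. Qed.

End compactness.

Theorem theorem1p2 (R : realType) (d : nat) (s : R) (M m : R -> R)
    (Omega : set 'rV[R]_d) :
  (2 <= d)%N -> 0 < s < 1 ->
  nfunction M -> nfunction_density M m ->
  open Omega -> bounded_set Omega ->
  C01_regular Omega -> bounded_set (boundary Omega) ->
  1 < lower_index M m ->
  ((lower_index M m)%:E <= upper_index M m)%E ->
  (upper_index M m < critical_exponent d (lower_index M m))%E ->
  (critical_exponent d (lower_index M m) < +oo)%E ->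
  (\int[lebesgue_measure]_(tau in `[0%R, 1%R])
     (conj_integrand d s M tau)%:E < +oo)%E ->
  (\int[lebesgue_measure]_(tau in `[1%R, +oo[)
     (conj_integrand d s M tau)%:E = +oo)%E ->
  continuous_embedding
    (frac_sobolev_space s M Omega) (frac_sobolev_norm s M Omega)
    (orlicz_space (sobolev_conj d s M) Omega)
    (luxemburg_norm (sobolev_conj d s M) Omega) /\
  (forall B : R -> R, nfunction B -> ndominated B (sobolev_conj d s M) ->
     compact_embedding
       (frac_sobolev_space s M Omega) (frac_sobolev_norm s M Omega)
       (orlicz_space B Omega) (luxemburg_norm B Omega)).
Proof.
move=> d2 /andP[s0 _] HM _ oO bO cO _ _ _ _ _ g_int g_inty.
have d0 : (0 < d)%N by exact: ltnW.
have mO := open_measurable_rV oO.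
have Ofin := bounded_lebesgue_lty mO bO.
have [del del0 cork] := C01_corkscrew d0 oO bO cO.
have dens := corkscrew_density del0 oO cork.
have [C C0 CP] := sobolev_modular_estimate d0 s0 HM g_int g_inty mO Ofin del0 dens.
split; first exact: (continuous_embedding_modular HM mO C0 CP).
move=> B HB BM.
apply: (dominated_compact_embedding d0 s0 HM oO Ofin _ _ _ _ HB BM C0 CP).
- exact: (sobolev_conj_le HM d0 s0 g_int g_inty).
- exact: (sobolev_conj_ge0 HM d0 s0 g_int g_inty).
- exact: (sobolev_conjZ_le HM d0 s0 g_int g_inty).
- exact: (measurable_sobolev_conj HM d0 s0 g_int g_inty).
Qed.
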